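(* There exists a constant $K>1$ such that for every open set $\Omega\subset \mathbb R^2$ and for every circle packing $\mathcal P$ inside $\Omega$, the residual set $\mathcal S$ of $\mathcal P$ satisfies $$\dim_{\mathscr H} (\mathcal S) >K>1.$$
   Context: A circle packing inside an open set $\Omega\subset\mathbb R^2$ is a countably infinite collection $\mathcal P=\{D_i\}_{i\in\mathbb N}$ of open round disks with $D_i\subset\Omega$ for all $i$ and $D_i\cap D_j=\emptyset$ for $i\ne j$ (closures may intersect). Its residual set is $\mathcal S=\Omega\setminus\bigcup_{i\in\mathbb N}D_i$. $\dim_{\mathscr H}$ denotes Hausdorff dimension.
   Formalization: The formal theorem assumes the residual set is nonempty; otherwise the claim fails, e.g. when Ω is the disjoint union of the open unit disks centered at (3i,0), taken as the packing, whose residual set is empty and has dimension 0. *)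

(* Defs.v *)
From HB Require Import structures.
From mathcomp Require Import all_boot all_order all_algebra.
From mathcomp Require Import all_classical all_reals all_analysis.

Set Implicit Arguments.
Unset Strict Implicit.
Unset Printing Implicit Defensive.

Import Order.TTheory GRing.Theory Num.Theory.
Import numFieldNormedType.Exports.

Local Open Scope classical_set_scope.
Local Open Scope ring_scope.

Section HausdorffDimension.
Context {R : realType} {T : Type} (d : T -> T -> R).
Local Open Scope ereal_scope.

(* 0 is adjoined so that diam set0 = 0 rather than -oo. *)
Definition diam (A : set T) : \bar R :=
  ereal_sup (0 |` [set (d p.1 p.2)%:E | p in A `*` A]).

(* (diam A)^s, where the empty set counts 0 also for s = 0 (poweR 0 0 = 1). *)
Definition diam_pow (s : R) (A : set T) : \bar R :=
  if A == set0 then 0 else poweR (diam A) s.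

(* Covers may contain empty sets, so sequences also account for finite covers. *)
Definition delta_cover (delta : R) (A : set T) (U : (set T)^nat) : Prop :=
  A `<=` \bigcup_i U i /\ forall i, diam (U i) <= delta%:E.

Definition hausdorff_premeasure (s delta : R) (A : set T) : \bar R :=
  ereal_inf [set \sum_(0 <= i <oo) diam_pow s (U i) | U in delta_cover delta A].

(* The premeasure is nonincreasing in delta: its limit at 0 is a supremum. *)
Definition hausdorff_measure (s : R) (A : set T) : \bar R :=
  ereal_sup [set hausdorff_premeasure s delta A
            | delta in [set delta : R | (0 < delta)%R]].

Definition hausdorff_dim (A : set T) : \bar R :=
  ereal_inf [set s%:E | s in [set s : R | (0 <= s)%R
                                          /\ hausdorff_measure s A = 0]].

End HausdorffDimension.

Section CirclePacking.
Context {R : realType}.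

(* The library norm on R * R is the sup norm; it induces the Euclidean topology
   but not the Euclidean distance. *)
Definition eucl_dist (p q : R * R) : R :=
  Num.sqrt ((p.1 - q.1) ^+ 2 + (p.2 - q.2) ^+ 2).

Definition open_disk (c : R * R) (r : R) : set (R * R) :=
  [set p | eucl_dist c p < r].

Definition is_open_disk (D : set (R * R)) : Prop :=
  exists c : R * R, exists2 r : R, 0 < r & D = open_disk c r.

(* Disks being nonempty, pairwise disjointness makes D injective, so that the
   collection is infinite. *)
Definition circle_packing (Omega : set (R * R)) (D : (set (R * R))^nat) : Prop :=
  [/\ forall i, is_open_disk (D i), forall i, D i `<=` Omega & trivIset setT D].

(* This is empty (hence of dimension 0) exactly when Omega is itself the
   disjoint union of the disks of the packing, e.g. for Omega the union of the
   unit disks centered at (3 i, 0), i in nat. *)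
Definition residual_set (Omega : set (R * R)) (D : (set (R * R))^nat) :
    set (R * R) :=
  Omega `\` \bigcup_i D i.

End CirclePacking.

(* Main.v *)
Require Import Defs.
From HB Require Import structures.
From mathcomp Require Import all_boot all_order all_algebra.
From mathcomp Require Import all_classical all_reals all_analysis.
From mathcomp Require Import ring lra.
Set Implicit Arguments.
Unset Strict Implicit.
Unset Printing Implicit Defensive.
Import Order.TTheory GRing.Theory Num.Theory.
Import numFieldNormedType.Exports.
Local Open Scope classical_set_scope.
Local Open Scope ring_scope.

(* Slice the packing by horizontal lines. After finitely many disks have been
   removed, a line meets the remaining set in finitely many gaps; let F be the
   sum over the lines of a fine grid of the sums of the t-th powers of the gap
   lengths. Insert the disks in order of decreasing radius. A disk of radius r
   splits a gap of length a + l + b, where l <= 2 r is its chord, into gaps of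
   lengths a and b, and a^t + b^t >= (a + l + b)^t + r^t / 2 as soon as
   a, b >= d r and t is small enough in terms of d. The opposite happens only on
   lines passing near the points where the disk faces one of its boundedly many
   neighbours of radius >= r, a small proportion of the lines meeting the disk.
   So F does not decrease: on average the lines meet the residual set in sets of
   dimension at least t, which makes the dimension of the residual set at least
   1 + t.

   Rigorously, let finitely many small sets, enlarged to squares, cover the
   residual set inside a square Q. Squares and disks are removed together by
   decreasing size until nothing is left, so that F ends at 0. Removing a
   square of half-side s costs at most a constant times s^(1+t); inserting a disk
   of radius r costs at most a constant times r^(1+t) if it crosses the boundary
   of a removed square, and a small multiple of r^(1+t) if it crosses the boundary
   of Q. An area bound and an averaging over the half-sides make the sums of these
   costs over all disks crossing one given boundary comparable to s^(1+t). Since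
   F is large at the start when Q is centered at a disk of comparable size free of
   larger disks, the sum of the s^(1+t) is bounded below. *)

(** * Powers and gaps on a line *)

Section PowerInequalities.
Context {R : realType}.
Implicit Types a b c l r x t d : R.

Lemma ler_powRl t x y : 0 <= t -> 0 <= x -> x <= y -> x `^ t <= y `^ t.
Proof.
move=> t0 x0 xy; apply: ge0_ler_powR => //; rewrite nnegrE //.
exact: le_trans xy.
Qed.

Lemma powR_bernoulli t x : 0 < t < 1 -> 0 <= x -> (1 + x) `^ t <= 1 + t * x.
Proof.
move=> /andP[t0 t1] x0.
have x1 : 0 <= 1 + x by rewrite addr_ge0.
have h : t + (1 - t) = 1 by rewrite addrC subrK.
have := @conjugate_powR R ((1 + x) `^ t) 1 t^-1 (1 - t)^-1.
rewrite powR_ge0 ler01 !invr_gt0 t0 subr_gt0 t1 !invrK => /(_ isT isT isT isT h).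
rewrite powR1 mulr1 mul1r -powRrM divff ?gt_eqF// powRr1//.
move=> /le_trans; apply; lra.
Qed.

(** The weights x/(x + y) and y/(x + y) lie in [0, 1] and add up to 1, and raising such a weight to
    a power t < 1 does not decrease it. *)
Lemma powR_subadd t x y : 0 < t < 1 -> 0 <= x -> 0 <= y ->
  (x + y) `^ t <= x `^ t + y `^ t.
Proof.
move=> /andP[t0 t1] x0 y0.
have [/eqP|xy0] := eqVneq (x + y) 0.
  by move=> /eqP ->; rewrite powR0 ?gt_eqF// addr_ge0// powR_ge0.
have xyp : 0 < x + y by rewrite lt_def xy0 addr_ge0.
have part z : 0 <= z -> z <= x + y -> z / (x + y) * (x + y) `^ t <= z `^ t.
  move=> z0 zs; have [->|zn] := eqVneq z 0; first by rewrite !mul0r powR_ge0.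
  have zp : 0 < z by rewrite lt_def zn.
  have -> : z `^ t = (z / (x + y)) `^ t * (x + y) `^ t.
    by rewrite -powRM ?divr_ge0// 1?ltW// mulfVK.
  rewrite ler_wpM2r ?powR_ge0//; apply: ger1_powR; last exact: ltW.
  by rewrite divr_gt0//= ler_pdivrMr// mul1r.
have hx : x <= x + y by rewrite lerDl.
have hy : y <= x + y by rewrite lerDr.
have := lerD (part x x0 hx) (part y y0 hy).
by rewrite -mulrDl -mulrDl divff// mul1r.
Qed.

(** By concavity the increment over a step l is at most l times the slope at b, and the slope t
    b^(t-1) only grows when b is replaced by the smaller a. *)
Lemma powR_incr_le t a b l : 0 < t < 1 -> 0 <= l -> 0 < a -> a <= b ->
  (b + l) `^ t - b `^ t <= t * (l / a) * a `^ t.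
Proof.
move=> /andP[t0 t1] l0 a0 ab; have b0 : 0 < b by apply: lt_le_trans ab.
have -> : (b + l) `^ t = b `^ t * (1 + l / b) `^ t.
  rewrite -powRM ?(ltW b0)//; last by rewrite addr_ge0// divr_ge0// ltW.
  by rewrite mulrDr mulr1 mulrC divfK// gt_eqF.
have lb : 0 <= l / b by rewrite divr_ge0// ltW.
have t01 : 0 < t < 1 by rewrite t0.
have := ler_wpM2l (powR_ge0 b t) (powR_bernoulli t01 lb).
move=> H; apply: (@le_trans _ _ (b `^ t * (t * (l / b)))); first by lra.
have pw z : 0 < z -> z^-1 * z `^ t = z `^ (t - 1).
  move=> z0; rewrite -[z in z^-1]powRr1 ?(ltW z0)// -powRN -powRD ?(gt_eqF z0) ?implybT//.
  by rewrite addrC.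
have -> : b `^ t * (t * (l / b)) = t * l * (b^-1 * b `^ t) by ring.
have -> : t * (l / a) * a `^ t = t * l * (a^-1 * a `^ t) by ring.
apply: ler_wpM2l; first by rewrite mulr_ge0// ltW.
rewrite !pw//.
have -> : t - 1 = - (1 - t) by ring.
rewrite !powRN lef_pV2 ?posrE ?powR_gt0//.
by apply: ler_powRl; rewrite ?subr_ge0; [exact: ltW|exact: ltW|exact: ab].
Qed.

End PowerInequalities.

(** * Sums of powers of the gaps left by intervals removed from a segment *)

Section GapSums.
Context {R : realType} (t : R) (t01 : 0 < t < 1).
Implicit Types (p q a b l r : R) (w : R * R) (s : seq (R * R)).

Definition gap_pow p q : R := (Num.max 0 (q - p)) `^ t.

(* The remaining pieces of [p, q] may be degenerate (q <= p): these contribute 0. *)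
Fixpoint gap_sum p q s : R :=
  if s is w :: s' then
    gap_sum p (Num.min q w.1) s' + gap_sum (Num.max p w.2) q s'
  else gap_pow p q.

Let t_ge0 : 0 <= t. Proof. by case/andP: t01 => /ltW. Qed.

Lemma gap_pow_ge0 p q : 0 <= gap_pow p q.
Proof. exact: powR_ge0. Qed.

Lemma gap_powE p q : p <= q -> gap_pow p q = (q - p) `^ t.
Proof. by move=> pq; rewrite /gap_pow max_r// subr_ge0. Qed.

Lemma gap_pow0 p q : q <= p -> gap_pow p q = 0.
Proof.
move=> qp; rewrite /gap_pow max_l ?subr_le0// powR0// gt_eqF//.
by case/andP: t01.
Qed.

Lemma gap_pow_le p q p' q' : p' <= p -> q <= q' -> gap_pow p q <= gap_pow p' q'.
Proof.
move=> pp qq; apply: ler_powRl => //; first by rewrite le_max lexx.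
by rewrite ge_max !le_max lexx /= lerB// orbT.
Qed.

Lemma gap_sum_ge0 p q s : 0 <= gap_sum p q s.
Proof.
elim: s p q => [|w s IH] p q /=; first exact: gap_pow_ge0.
by rewrite addr_ge0.
Qed.

(** The pieces are closed and the removed intervals open: a piece left by [w] misses [w], so the
    remaining intervals cover it. In the end only degenerate pieces are left. *)
Lemma gap_sum_covered p q s :
  (forall x, p <= x <= q -> exists2 w, w \in s & w.1 < x < w.2) ->
  gap_sum p q s = 0.
Proof.
elim: s p q => [|w s IH] p q cov.
  have [pq|/ltW qp] := leP p q; last exact: gap_pow0.
  by have [w] := cov p ltac:(by rewrite lexx).
rewrite /= !IH ?addr0// => x /andP[].
- rewrite ge_max => /andP[px wx] xq.
  have [w'] := cov x ltac:(by rewrite px).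
  rewrite inE => /orP[/eqP ->|]; last by exists w'.
  by rewrite [x < _]ltNge wx andbF.
- rewrite le_min => px /andP[xq xw].
  have [w'] := cov x ltac:(by rewrite px).
  rewrite inE => /orP[/eqP ->|]; last by exists w'.
  by rewrite ltNge xw.
Qed.

Lemma gap_sum_rcons_disj p q s w : w.1 <= w.2 -> q <= w.1 \/ w.2 <= p ->
  gap_sum p q (rcons s w) = gap_sum p q s.
Proof.
move=> w12; elim: s p q => [|w' s IH] p q dj /=.
  case: dj => [qw|wp].
    by rewrite min_l// [X in _ + X]gap_pow0 ?addr0// le_max (le_trans qw w12) orbT.
  rewrite (@max_l _ _ p)// [X in X + _]gap_pow0 ?add0r//.
  by rewrite ge_min (le_trans w12 wp) orbT.
rewrite !IH//; case: dj => h; [left|right|left|right] => //.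
- by rewrite le_max h.
- by rewrite ge_min h.
Qed.

(** After the removal of [w'] every piece lies on one side of it, hence on one side of [w]. *)
Lemma gap_sum_rcons_inside p q s w w' : w.1 <= w.2 -> w' \in s ->
  w'.1 <= w.1 -> w.2 <= w'.2 -> gap_sum p q (rcons s w) = gap_sum p q s.
Proof.
move=> w12 + h1 h2; elim: s p q => [|w0 s IH] p q //.
rewrite inE /= => /orP[/eqP <-|w's]; last by rewrite !IH.
by rewrite !gap_sum_rcons_disj//; [right; rewrite le_max h2 orbT|
  left; rewrite ge_min h1 orbT].
Qed.

Definition strictly_inside w w' := (w.1 < w'.1) && (w'.2 < w.2).

(** In a single gap the loss is bounded by subadditivity. When an earlier interval cuts a gap, [w]
    can affect both pieces only if that interval is strictly inside [w]; each such interval at most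
    doubles the loss. *)
Lemma gap_sum_rcons_cost p q s w : w.1 <= w.2 ->
  gap_sum p q s - 2 ^+ count (strictly_inside w) s * (w.2 - w.1) `^ t
    <= gap_sum p q (rcons s w).
Proof.
move=> w12; have len0 : 0 <= w.2 - w.1 by rewrite subr_ge0.
have len_ge0 : 0 <= (w.2 - w.1) `^ t by exact: powR_ge0.
elim: s p q => [|w' s IH] p q /=.
  rewrite expr0 mul1r.
  set a := Num.max 0 (Num.min q w.1 - p); set b := Num.max 0 (q - Num.max p w.2).
  have a0 : 0 <= a by rewrite le_max lexx.
  have b0 : 0 <= b by rewrite le_max lexx.
  have le_abl : Num.max 0 (q - p) <= a + (b + (w.2 - w.1)).
    rewrite ge_max (addr_ge0 a0 (addr_ge0 b0 len0)) /=.
    have ha : Num.min q w.1 - p <= a by rewrite /a le_max lexx orbT.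
    have hb : q - Num.max p w.2 <= b by rewrite /b le_max lexx orbT.
    by move: ha hb; have [? | ?] := leP q w.1; have [? | ?] := leP p w.2; lra.
  have m0 : 0 <= Num.max 0 (q - p) by rewrite le_max lexx.
  have := ler_powRl t_ge0 m0 le_abl.
  move=> /le_trans /(_ (powR_subadd t01 a0 (addr_ge0 b0 len0))) h.
  have := powR_subadd t01 b0 len0; rewrite /gap_pow -/a -/b.
  by move: h; lra.
have pow2 n : (1 : R) <= 2 ^+ n by rewrite exprn_ege1// ler1n.
have [inside|] := boolP (strictly_inside w w').
  rewrite exprS; have := lerD (IH p (Num.min q w'.1)) (IH (Num.max p w'.2) q).
  lra.
rewrite add0n => outside.
have /orP[h|h] : (w'.1 <= w.1) || (w.2 <= w'.2).
  by move: outside; rewrite negb_and -!leNgt.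
- rewrite [X in _ <= X + _]gap_sum_rcons_disj//; last by left; rewrite ge_min h orbT.
  by have := IH (Num.max p w'.2) q; lra.
- rewrite [X in _ <= _ + X]gap_sum_rcons_disj//; last by right; rewrite le_max h orbT.
  by have := IH p (Num.min q w'.1); lra.
Qed.

Lemma gap_sum_ge_interval p q s u v : p <= u -> u <= v -> v <= q ->
  (forall w, w \in s -> w.1 <= w.2 /\ (w.2 <= u \/ v <= w.1)) ->
  (v - u) `^ t <= gap_sum p q s.
Proof.
elim: s p q => [|w s IH] p q pu uv vq dj /=.
  rewrite -gap_powE//; exact: gap_pow_le.
have djs w' : w' \in s -> w'.1 <= w'.2 /\ (w'.2 <= u \/ v <= w'.1).
  by move=> w's; apply: dj; rewrite inE w's orbT.
have [_ [h|h]] := dj w (mem_head _ _).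
- by rewrite ler_wpDl ?gap_sum_ge0// IH// ge_max pu.
- by rewrite ler_wpDr ?gap_sum_ge0// IH// le_min vq.
Qed.

Context (d : R) (d01 : 0 < d <= 1).

(** Let b be the shorter side. Since l <= 2 r <= 2 b / d, adding b + l to a increases the power by
    at most 3 (t/d) b^t, whereas the separate piece b contributes b^t. The difference is at least (1
    - 3 t/d) (d r)^t. *)
Lemma split_gain a b l r : 0 < r -> 0 <= l <= 2 * r -> d * r <= a -> d * r <= b ->
  2^-1 <= d `^ t * (1 - 3 * (t / d)) ->
  (a + b + l) `^ t + 2^-1 * r `^ t <= a `^ t + b `^ t.
Proof.
move=> r0 /andP[l0 l2]; case/andP: (d01) => d0 d1; case/andP: (t01) => t0 t1.
wlog ba : a b / b <= a.
  move=> W ha hb hd; have [ba|/ltW ab] := leP b a; first exact: W.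
  by rewrite [a + b]addrC [X in _ <= X]addrC; apply: W.
move=> ha hb hd.
have dr0 : 0 < d * r by rewrite mulr_gt0.
have b0 : 0 < b by apply: lt_le_trans hb.
have bl0 : 0 <= b + l by rewrite addr_ge0// ltW.
have := powR_incr_le t01 bl0 b0 ba.
have -> : a + (b + l) = a + b + l by rewrite addrA.
have lb : (b + l) / b <= 3 / d.
  rewrite ler_pdivrMr// mulrAC ler_pdivlMr//.
  have : d * b <= b by rewrite ler_piMl// ltW.
  have : d * l <= 2 * b.
    apply: (@le_trans _ _ (2 * (d * r))); last by rewrite ler_pM2l.
    by rewrite mulrCA ler_pM2l.
  have -> : (b + l) * d = d * b + d * l by ring.
  lra.
have drb := ler_powRl t_ge0 (ltW dr0) hb.
have h1 : t * ((b + l) / b) * b `^ t <= 3 * (t / d) * b `^ t.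
  rewrite ler_wpM2r ?powR_ge0//.
  have -> : 3 * (t / d) = t * (3 / d) by ring.
  by rewrite ler_pM2l.
have h2 : 2^-1 * r `^ t <= (d * r) `^ t * (1 - 3 * (t / d)).
  rewrite powRM ?(ltW d0) ?(ltW r0)// mulrAC ler_wpM2r// ?powR_ge0//.
have td : 0 <= 1 - 3 * (t / d).
  rewrite leNgt; apply/negP => neg.
  have : d `^ t * (1 - 3 * (t / d)) <= 0 by rewrite mulr_ge0_le0 ?powR_ge0// ltW.
  by move: hd; lra.
have h3 : (d * r) `^ t * (1 - 3 * (t / d)) <= b `^ t * (1 - 3 * (t / d)).
  by rewrite ler_wpM2r.
move=> h4; lra.
Qed.

(** Here only b is known to be long. Subadditivity detaches a, and lengthening b >= d r by l <= 2 r
    costs at most 2 (t/d) r^t, which is small when t is small compared with d. *)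
Lemma split_loss a b l r : 0 < r -> 0 <= l <= 2 * r -> 0 <= a -> d * r <= b ->
  (a + b + l) `^ t <= a `^ t + b `^ t + 2 * (t / d) * r `^ t.
Proof.
move=> r0 /andP[l0 l2] a0 hb; case/andP: (d01) => d0 d1; case/andP: (t01) => t0 t1.
have dr0 : 0 < d * r by rewrite mulr_gt0.
have b0 : 0 < b by apply: lt_le_trans hb.
have bl0 : 0 <= b + l by rewrite addr_ge0// ltW.
have := powR_subadd t01 a0 bl0; rewrite addrA => h1.
have h2 := powR_incr_le t01 l0 dr0 hb.
have h3 : t * (l / (d * r)) * (d * r) `^ t <= 2 * (t / d) * r `^ t.
  apply: ler_pM; rewrite ?powR_ge0//.
  - by rewrite mulr_ge0// ?(ltW t0)// divr_ge0// ltW.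
  - have -> : 2 * (t / d) = t * (2 / d) by ring.
    rewrite ler_pM2l// ler_pdivrMr// mulrA divfK ?gt_eqF//.
  - apply: ler_powRl => //; first exact: ltW.
    by rewrite ler_piMl// ltW.
lra.
Qed.

(** The margin d r on both sides of [w] persists at every cut, so that [w] falls into a single gap,
    to which [split_gain] applies. *)
Lemma gap_sum_rcons_gain p q s w r : 0 < r -> w.1 <= w.2 -> w.2 - w.1 <= 2 * r ->
  2^-1 <= d `^ t * (1 - 3 * (t / d)) ->
  (forall w', w' \in s ->
     w'.1 <= w'.2 /\ (w'.2 + d * r <= w.1 \/ w.2 + d * r <= w'.1)) ->
  p + d * r <= w.1 -> w.2 + d * r <= q ->
  gap_sum p q s + 2^-1 * r `^ t <= gap_sum p q (rcons s w).
Proof.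
move=> r0 w12 wr hd; case/andP: (d01) => d0 d1.
have dr0 : 0 < d * r by rewrite mulr_gt0.
elim: s p q => [|w' s IH] p q sep hp hq /=.
  rewrite min_r ?max_r; [|lra|lra].
  rewrite !gap_powE; [|lra|lra|lra].
  have -> : q - p = (w.1 - p) + (q - w.2) + (w.2 - w.1) by ring.
  by apply: split_gain => //; [rewrite subr_ge0 w12|lra|lra].
have seps w0 : w0 \in s ->
    w0.1 <= w0.2 /\ (w0.2 + d * r <= w.1 \/ w.2 + d * r <= w0.1).
  by move=> w0s; apply: sep; rewrite inE w0s orbT.
have [w'12 [h|h]] := sep w' (mem_head _ _).
- rewrite [X in _ <= X + _]gap_sum_rcons_disj//; last first.
    by left; rewrite ge_min; apply/orP; right; lra.
  rewrite -addrA lerD2l; apply: IH => //.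
  by have [] := leP p w'.2; lra.
- rewrite [X in _ <= _ + X]gap_sum_rcons_disj//; last first.
    by right; rewrite le_max; apply/orP; right; lra.
  rewrite addrAC lerD2r; apply: IH => //.
  by have [] := leP q w'.1; lra.
Qed.

(** The variant for an interval that may come close to one end of [p, q], or stick out there: a
    margin is left on the other side, and [split_loss] applies. *)
Lemma gap_sum_rcons_loss p q s w r : 0 < r -> w.1 <= w.2 -> w.2 - w.1 <= 2 * r ->
  (forall w', w' \in s ->
     w'.1 <= w'.2 /\ (w'.2 + d * r <= w.1 \/ w.2 + d * r <= w'.1)) ->
  p + d * r <= w.1 \/ w.2 + d * r <= q ->
  gap_sum p q s - 2 * (t / d) * r `^ t <= gap_sum p q (rcons s w).
Proof.
move=> r0 w12 wr; case/andP: (d01) => d0 d1; case/andP: (t01) => t0 t1.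
have dr0 : 0 < d * r by rewrite mulr_gt0.
have loss0 : 0 <= 2 * (t / d) * r `^ t.
  by rewrite mulr_ge0 ?powR_ge0// mulr_ge0// divr_ge0// ltW.
elim: s p q => [|w' s IH] p q sep hpq.
  have [wp|pw] := leP w.2 p.
    by rewrite gap_sum_rcons_disj; [lra| |right].
  have [qw|wq] := leP q w.1.
    by rewrite gap_sum_rcons_disj; [lra| |left].
  rewrite /= min_r ?max_r ?(ltW pw) ?(ltW wq)//.
  rewrite (@gap_powE p q); last lra.
  case: hpq => h.
  - rewrite (@gap_powE p w.1); last lra.
    have [wq'|qw'] := leP w.2 q.
      rewrite gap_powE//.
      have -> : q - p = (q - w.2) + (w.1 - p) + (w.2 - w.1) by ring.
      have := @split_loss (q - w.2) (w.1 - p) (w.2 - w.1) r r0.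
      move=> /(_ ltac:(lra) ltac:(lra) ltac:(lra)); lra.
    rewrite gap_pow0 ?(ltW qw')//.
    (* [w] sticks out beyond q: the removed part ends at q and the second piece has length 0. *)
    have := @split_loss 0 (w.1 - p) (q - w.1) r r0.
    move=> /(_ ltac:(lra) ltac:(lra) ltac:(lra)).
    rewrite powR0 ?(gt_eqF t0)//.
    have -> : 0 + (w.1 - p) + (q - w.1) = q - p by ring.
    lra.
  - rewrite (@gap_powE w.2 q); last lra.
    have [pw'|wp'] := leP p w.1.
      rewrite gap_powE//.
      have -> : q - p = (w.1 - p) + (q - w.2) + (w.2 - w.1) by ring.
      have := @split_loss (w.1 - p) (q - w.2) (w.2 - w.1) r r0.
      move=> /(_ ltac:(lra) ltac:(lra) ltac:(lra)); lra.
    rewrite gap_pow0 ?(ltW wp')//.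
    have := @split_loss 0 (q - w.2) (w.2 - p) r r0.
    move=> /(_ ltac:(lra) ltac:(lra) ltac:(lra)).
    rewrite powR0 ?(gt_eqF t0)//.
    have -> : 0 + (q - w.2) + (w.2 - p) = q - p by ring.
    lra.
have seps w0 : w0 \in s ->
    w0.1 <= w0.2 /\ (w0.2 + d * r <= w.1 \/ w.2 + d * r <= w0.1).
  by move=> w0s; apply: sep; rewrite inE w0s orbT.
have [w'12 [h|h]] := sep w' (mem_head _ _) => /=.
- rewrite [X in _ <= X + _]gap_sum_rcons_disj//; last first.
    by left; rewrite ge_min; apply/orP; right; lra.
  rewrite -addrA lerD2l; apply: IH => //.
  by case: hpq => hp; [left; have [] := leP p w'.2; lra|right].
- rewrite [X in _ <= _ + X]gap_sum_rcons_disj//; last first.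
    by right; rewrite le_max; apply/orP; right; lra.
  rewrite addrAC lerD2r; apply: IH => //.
  by case: hpq => hp; [left|right; have [] := leP q w'.1; lra].
Qed.

End GapSums.

(** * Disjoint disks in the plane *)

Section PlaneGeometry.
Context {R : realType}.
Implicit Types (p q c z : R * R) (r a b y : R).

Definition sqdist p q : R := (p.1 - q.1) ^+ 2 + (p.2 - q.2) ^+ 2.

Lemma sqdistC p q : sqdist p q = sqdist q p.
Proof. rewrite /sqdist; ring. Qed.

Lemma sqdist_ge0 p q : 0 <= sqdist p q.
Proof. by rewrite addr_ge0// sqr_ge0. Qed.

Lemma ler_sqr_of r a : 0 <= a -> r ^+ 2 <= a ^+ 2 -> - a <= r <= a.
Proof.
by move=> a0 h; rewrite -ler_norml -(@ler_pXn2r _ 2)// ?nnegrE// real_normK ?num_real.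
Qed.

(** Lagrange's identity: the defect in the Cauchy-Schwarz inequality is the square of the cross
    product. *)
Lemma cauchy_schwarz2 (x1 x2 y1 y2 a b : R) : 0 <= a -> 0 <= b ->
  x1 ^+ 2 + x2 ^+ 2 <= a ^+ 2 -> y1 ^+ 2 + y2 ^+ 2 <= b ^+ 2 ->
  - (a * b) <= x1 * y1 + x2 * y2 <= a * b.
Proof.
move=> a0 b0 hx hy; apply: ler_sqr_of; first exact: mulr_ge0.
rewrite exprMn; apply: (@le_trans _ _ ((x1 ^+ 2 + x2 ^+ 2) * (y1 ^+ 2 + y2 ^+ 2))).
  rewrite -subr_ge0.
  have -> : (x1 ^+ 2 + x2 ^+ 2) * (y1 ^+ 2 + y2 ^+ 2) - (x1 * y1 + x2 * y2) ^+ 2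
    = (x1 * y2 - x2 * y1) ^+ 2 by ring.
  exact: sqr_ge0.
by apply: ler_pM => //; rewrite addr_ge0// sqr_ge0.
Qed.

Lemma sqdist_triangle p q c a b : 0 <= a -> 0 <= b ->
  sqdist p q <= a ^+ 2 -> sqdist q c <= b ^+ 2 -> sqdist p c <= (a + b) ^+ 2.
Proof.
move=> a0 b0 pq qc; have /andP[_] := cauchy_schwarz2 a0 b0 pq qc.
move: pq qc; rewrite /sqdist => pq qc cs.
have -> : (p.1 - c.1) ^+ 2 + (p.2 - c.2) ^+ 2 =
  ((p.1 - q.1) ^+ 2 + (p.2 - q.2) ^+ 2) + ((q.1 - c.1) ^+ 2 + (q.2 - c.2) ^+ 2)
  + 2 * ((p.1 - q.1) * (q.1 - c.1) + (p.2 - q.2) * (q.2 - c.2)) by ring.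
by rewrite sqrrD; lra.
Qed.

(** The height of the point where the circle of center [c] and radius [r] meets the ray from [c]
    towards [c']. *)
Definition tangent_height c r c' : R :=
  c.2 + r * (c'.2 - c.2) / Num.sqrt (sqdist c c').

(* Two points at the same height on two disjoint disks and at distance at most
   d r from each other project onto the line of centers within [(1 - d) r, r]
   for the point on the first circle, which is therefore close to the point
   of that circle facing the second disk. *)
Lemma near_tangency c c' r r' d b (u u' y : R) :
  0 < r -> 0 < r' -> 0 <= b -> b ^+ 2 = 2 * d -> 0 <= d ->
  (r + r') ^+ 2 <= sqdist c c' ->
  sqdist (u, y) c = r ^+ 2 -> sqdist (u', y) c' = r' ^+ 2 ->
  - (d * r) <= u - u' <= d * r ->
  - (b * r) <= y - tangent_height c r c' <= b * r.
Proof.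
move=> r0 r'0 b0 bd d0 sep uc u'c' /andP[uu1 uu2].
set D := Num.sqrt (sqdist c c').
have D2 : D ^+ 2 = sqdist c c' by rewrite sqr_sqrtr// sqdist_ge0.
have rr0 : 0 < r + r' by rewrite addr_gt0.
have DD : r + r' <= D.
  by rewrite -(@ler_pXn2r _ 2) ?nnegrE ?sqrtr_ge0 ?(ltW rr0)// D2.
have D0 : 0 < D by apply: lt_le_trans DD.
pose e1 := (c'.1 - c.1) / D; pose e2 := (c'.2 - c.2) / D.
have e12 : e1 ^+ 2 + e2 ^+ 2 = 1.
  rewrite /e1 /e2 !expr_div_n -mulrDl D2 /sqdist.
  rewrite -[c.1 - _]opprB -[c.2 - _]opprB !sqrrN divff//.
  move: D2; rewrite /sqdist -[c.1 - _]opprB -[c.2 - _]opprB !sqrrN => <-.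
  by rewrite expf_neq0// gt_eqF.
have E1 : c'.1 = c.1 + D * e1 by rewrite /e1 mulrC divfK ?gt_eqF//; ring.
have E2 : c'.2 = c.2 + D * e2 by rewrite /e2 mulrC divfK ?gt_eqF//; ring.
have -> : tangent_height c r c' = c.2 + r * e2.
  by rewrite /tangent_height -/D /e2 mulrA.
have one : 1 ^+ 2 = 1 :> R by rewrite expr1n.
have e12' : e1 ^+ 2 + e2 ^+ 2 <= 1 ^+ 2 by rewrite e12 one.
have u'le : (u' - c'.1) ^+ 2 + (y - c'.2) ^+ 2 <= r' ^+ 2.
  by move: u'c'; rewrite /sqdist /= => ->.
have /andP[g1 _] := cauchy_schwarz2 (ltW r'0) ler01 u'le e12'.
have e1le : - 1 <= e1 <= 1.
  apply: ler_sqr_of => //; rewrite one -e12; have := sqr_ge0 e2; lra.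
(* The centers are at least r + r' apart along the unit vector (e1, e2), and the second point falls
   short of its own center by at most r'. *)
have h1 : r <= (u' - c.1) * e1 + (y - c.2) * e2.
  have -> : (u' - c.1) * e1 + (y - c.2) * e2 =
    (u' - c'.1) * e1 + (y - c'.2) * e2 + D * (e1 ^+ 2 + e2 ^+ 2).
    by rewrite E1 E2; ring.
  rewrite e12; move: g1; lra.
have h2 : - (d * r) <= (u - u') * e1.
  have dr0 : 0 <= d * r by rewrite mulr_ge0// ltW.
  case/andP: e1le => e1a e1b; nra.
have h3 : (1 - d) * r <= (u - c.1) * e1 + (y - c.2) * e2.
  have -> : (u - c.1) * e1 + (y - c.2) * e2 =
    ((u' - c.1) * e1 + (y - c.2) * e2) + (u - u') * e1 by ring.
  lra.
apply: ler_sqr_of; first by rewrite mulr_ge0// ltW.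
have -> : y - (c.2 + r * e2) = (y - c.2) - r * e2 by ring.
(* The squared distance to the facing point is 2 r^2 minus 2 r times the projection, so at most 2 d
   r^2: this is where [b ^+ 2 = 2 * d] comes from. *)
have H : ((u - c.1) - r * e1) ^+ 2 + ((y - c.2) - r * e2) ^+ 2 =
  r ^+ 2 + r ^+ 2 * (e1 ^+ 2 + e2 ^+ 2)
  - 2 * r * ((u - c.1) * e1 + (y - c.2) * e2).
  by rewrite -{1}uc /sqdist /=; ring.
have := sqr_ge0 ((u - c.1) - r * e1) => sq0.
have h4 : r * ((1 - d) * r) <= r * ((u - c.1) * e1 + (y - c.2) * e2).
  by rewrite ler_pM2l.
rewrite exprMn bd; move: H; rewrite e12; lra.
Qed.

(* Moving the centers towards z and shrinking the radii to r keeps the disks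
   disjoint and brings the centers within 3 r of z, where each cell of a 7 x 7
   grid of mesh r contains at most one of them. *)
Lemma packing_bound (n : nat) (c : 'I_n -> R * R) (rr : 'I_n -> R) z r :
  0 < r -> (forall i, r <= rr i) ->
  (forall i, sqdist (c i) z <= (rr i + 2 * r) ^+ 2) ->
  (forall i j, i != j -> (rr i + rr j) ^+ 2 <= sqdist (c i) (c j)) ->
  (n <= 49)%N.
Proof.
move=> r0 rle near sep.
(* This fraction moves each center by at most [rr i - r] and leaves it within (1 - l) (rr i + 2 r) =
   3 r of z. *)
pose l i := (rr i - r) / (rr i + 2 * r).
have den i : 0 < rr i + 2 * r by have := rle i; lra.
pose c' i := ((c i).1 + l i * (z.1 - (c i).1), (c i).2 + l i * (z.2 - (c i).2)).
have cc' i : sqdist (c' i) (c i) <= (rr i - r) ^+ 2.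
  have -> : sqdist (c' i) (c i) = l i ^+ 2 * sqdist (c i) z.
    by rewrite /sqdist /c' /=; ring.
  have -> : (rr i - r) ^+ 2 = l i ^+ 2 * (rr i + 2 * r) ^+ 2.
    by rewrite -exprMn /l divfK// gt_eqF.
  by rewrite ler_wpM2l// sqr_ge0.
have c'z i : sqdist (c' i) z <= (3 * r) ^+ 2.
  have -> : sqdist (c' i) z = (1 - l i) ^+ 2 * sqdist (c i) z.
    by rewrite /sqdist /c' /=; ring.
  have -> : 3 * r = (1 - l i) * (rr i + 2 * r).
    by rewrite mulrBl /l divfK ?gt_eqF//; ring.
  by rewrite exprMn ler_wpM2l// sqr_ge0.
(* The factor 3/2 lies between the diagonal of a unit cell, sqrt 2, and the separation 2 of unit
   disks. *)
have sep' i j : i != j -> (3 / 2 * r) ^+ 2 < sqdist (c' i) (c' j).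
  move=> ij; rewrite ltNge; apply/negP => close.
  have := sep i j ij; rewrite leNgt => /negP; apply.
  have ri : 0 <= rr i - r by rewrite subr_ge0.
  have rj : 0 <= rr j - r by rewrite subr_ge0.
  have r32 : 0 <= 3 / 2 * r by lra.
  have := cc' i; rewrite sqdistC => ci.
  have h1 := sqdist_triangle ri r32 ci close.
  have h2 := sqdist_triangle (addr_ge0 ri r32) rj h1 (cc' j).
  apply: le_lt_trans h2 _; rewrite ltr_pXn2r ?nnegrE//; have := rle i; have := rle j; lra.
(* The offset x/r + 3 ranges over the closed interval [0, 6], so its integer part takes 7 values. *)
pose cell (x : R) := Num.truncn (x / r + 3).
have cellP x : - (3 * r) <= x <= 3 * r ->
    (cell x < 7)%N /\ (cell x)%:R <= x / r + 3 < (cell x).+1%:R.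
  move=> /andP[x1 x2].
  have xr1 : -3 <= x / r by rewrite ler_pdivlMr//; lra.
  have xr2 : x / r <= 3 by rewrite ler_pdivrMr//; lra.
  have pos : 0 <= x / r + 3 by lra.
  have /andP[h1 h2] := truncn_itv pos.
  split; last by rewrite h1.
  rewrite ltnNge; apply/negP => big.
  have : (7%:R : R) <= (cell x)%:R by rewrite ler_nat.
  by rewrite -/(cell x) in h1 h2; lra.
have cz i : (- (3 * r) <= (c' i).1 - z.1 <= 3 * r) /\ (- (3 * r) <= (c' i).2 - z.2 <= 3 * r).
  have r30 : 0 <= 3 * r by lra.
  have := c'z i; rewrite /sqdist.
  have := sqr_ge0 ((c' i).1 - z.1); have := sqr_ge0 ((c' i).2 - z.2).
  by move=> ? ? ?; split; apply: ler_sqr_of => //; lra.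
pose f i : 'I_7 * 'I_7 :=
  (inord (cell ((c' i).1 - z.1)), inord (cell ((c' i).2 - z.2))).
have same x x' : - (3 * r) <= x <= 3 * r -> - (3 * r) <= x' <= 3 * r ->
    inord (cell x) = inord (cell x') :> 'I_7 -> (x - x') ^+ 2 <= r ^+ 2.
  move=> /cellP[c7 /andP[h1 h2]] /cellP[c7' /andP[h1' h2']] /(congr1 val) /=.
  rewrite !inordK// => e; rewrite -e in h1' h2'.
  have hh : - 1 <= (x - x') / r <= 1.
    by rewrite mulrBl; move: h1 h2 h1' h2'; rewrite -natr1; lra.
  have -> : x - x' = (x - x') / r * r by rewrite divfK// gt_eqF.
  have : ((x - x') / r) ^+ 2 <= 1 by case/andP: hh => ? ?; nra.
  by move=> h; rewrite exprMn ler_piMl// sqr_ge0.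
have finj : injective f.
  move=> i j [e1 e2]; apply/eqP; apply/negPn/negP => ij.
  have := sep' i j ij; rewrite ltNge => /negP; apply.
  have := same _ _ (cz i).1 (cz j).1 e1; have := same _ _ (cz i).2 (cz j).2 e2.
  have -> : (c' i).1 - z.1 - ((c' j).1 - z.1) = (c' i).1 - (c' j).1 by ring.
  have -> : (c' i).2 - z.2 - ((c' j).2 - z.2) = (c' i).2 - (c' j).2 by ring.
  move=> h1 h2; rewrite /sqdist exprMn.
  have r20 : 0 <= r ^+ 2 by exact: sqr_ge0.
  lra.
by have := leq_card f finj; rewrite card_prod !card_ord.
Qed.

End PlaneGeometry.

(** * Counting grid points in intervals *)

Section Counting.
Context {R : realType}.

(** When M is counted, the upper end can be lowered to M - 1 for the smaller integers, and this
    lowers the bound by at least 1. *)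
Lemma count_le (M : nat) (a b : R) :
  \sum_(k < M) (a <= k%:R <= b)%R%:R <= Num.max 0 (b - a + 1).
Proof.
elim: M b => [|M IH] b; first by rewrite big_ord0 le_max lexx.
rewrite big_ord_recr /=.
have [/andP[aM Mb]|_] := boolP (a <= M%:R <= b); last by rewrite addr0.
have e : forall k : 'I_M, true -> (a <= k%:R <= b)%R%:R = (a <= k%:R <= (M%:R - 1 : R))%R%:R :> R.
  move=> [k kM] _ /=; congr ((_ : bool)%:R : R); congr (_ && _).
  have : (k.+1%:R : R) <= M%:R by rewrite ler_nat.
  by rewrite -natr1 => kM'; apply/idP/idP => _; lra.
rewrite (eq_bigr _ e).
apply: (@le_trans _ _ (Num.max 0 (M%:R - 1 - a + 1) + 1)).
  by rewrite lerD2r; exact: IH.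
by rewrite max_r ?le_max; [apply/orP; right|]; lra.
Qed.

(** The bounds on a and b confine all integers strictly between them to 0, ..., M - 1, so none is
    missed by the sum. *)
Lemma count_ge (M : nat) (a b : R) : -1 <= a -> b <= M%:R ->
  b - a - 1 <= \sum_(k < M) (a < k%:R < b)%R%:R.
Proof.
move=> a1; elim: M b => [|M IH] b bM; first by rewrite big_ord0; lra.
rewrite big_ord_recr /=; have [bM'|Mb] := leP b M%:R.
  by rewrite andbF addr0; exact: IH.
have [aM|Ma] := ltP a M%:R => /=; last first.
  by move: bM; rewrite -natr1 addr0 => bM; apply: (@le_trans _ _ 0);
    [lra|apply: sumr_ge0].
have e : forall k : 'I_M, true -> (a < k%:R < b)%R%:R = (a < k%:R < (M%:R : R))%R%:R :> R.
  move=> [k kM] _ /=; congr ((_ : bool)%:R : R); congr (_ && _).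
  have kM' : (k%:R : R) < M%:R by rewrite ltr_nat.
  by rewrite kM'; apply/idP; lra.
rewrite (eq_bigr _ e).
have := IH M%:R (lexx _); move: bM; rewrite -natr1; lra.
Qed.

Lemma grid_count_le (M : nat) (y0 h c l : R) : 0 < h -> 0 <= l ->
  \sum_(k < M) (- l <= y0 + k.+1%:R * h - c <= l)%R%:R <= 2 * (l / h) + 1.
Proof.
move=> h0 l0; have := count_le M ((c - l - y0) / h - 1) ((c + l - y0) / h - 1).
have -> : (c + l - y0) / h - 1 - ((c - l - y0) / h - 1) + 1 = 2 * (l / h) + 1.
  by ring.
rewrite max_r; last by rewrite addr_ge0// mulr_ge0// divr_ge0// ltW.
apply: le_trans; apply: ler_sum => -[k kM] _ /=.
rewrite ler_nat; case: (boolP (- l <= _ <= _)) => // /andP[h1 h2].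
rewrite lerBlDr ler_pdivrMr// lerBrDr ler_pdivlMr//.
have -> : (c - l - y0 <= (k%:R + 1) * h) && ((k%:R + 1) * h <= c + l - y0) = true.
  by rewrite natr1; apply/andP; split; lra.
by [].
Qed.

Lemma grid_count_ge (M : nat) (y0 h c l : R) : 0 < h ->
  y0 <= c - l -> c + l <= y0 + M.+1%:R * h ->
  2 * (l / h) - 1 <= \sum_(k < M) (- l < y0 + k.+1%:R * h - c < l)%R%:R.
Proof.
move=> h0 lo hi.
have := @count_ge M ((c - l - y0) / h - 1) ((c + l - y0) / h - 1).
have -> : (c + l - y0) / h - 1 - ((c - l - y0) / h - 1) - 1 = 2 * (l / h) - 1.
  by ring.
have a1 : -1 <= (c - l - y0) / h - 1.
  by rewrite lerDr divr_ge0 ?(ltW h0)//; lra.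
have b1 : (c + l - y0) / h - 1 <= M%:R.
  by rewrite lerBlDr natr1 ler_pdivrMr//; lra.
move=> /(_ a1 b1) /le_trans; apply; apply: ler_sum => -[k kM] _ /=.
rewrite ler_nat; case: (boolP (_ < k%:R < _)) => //.
rewrite ltrBlDr ltr_pdivrMr// ltrBrDr ltr_pdivlMr// natr1 => /andP[h1 h2].
have -> : (- l < y0 + k.+1%:R * h - c < l) = true by apply/andP; split; lra.
by [].
Qed.

Lemma sum_indic_le1 (I : finType) (P b : pred I) :
  (forall i j, P i -> P j -> i != j -> b i -> b j -> False) ->
  \sum_(i | P i) (b i)%:R <= 1 :> R.
Proof.
move=> excl; case: (pickP [pred i | P i && b i]) => [i /andP[Pi bi]|none].
  rewrite (bigD1 i)//= big1 ?addr0; first by rewrite bi.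
  move=> j /andP[Pj ji]; case: (boolP (b j)) => // bj.
  by case: (excl j i Pj Pi ji bj bi).
rewrite big1// => i Pi; have := none i; rewrite /= Pi /= => ->.
by [].
Qed.

Lemma finite_pos_lower_bound (n : nat) (f : 'I_n -> R) :
  (forall i, 0 < f i) -> exists2 e, 0 < e & forall i, e <= f i.
Proof.
elim: n f => [|n IH] f f0; first by exists 1 => // -[].
have [e e0 He] := IH (fun i => f (lift ord0 i)) (fun i => f0 _).
exists (Num.min e (f ord0)); first by rewrite lt_min e0 f0.
move=> i; case: (unliftP ord0 i) => [j ->|->]; rewrite ge_min.
- by rewrite He.
- by rewrite lexx orbT.
Qed.

Lemma fine_mesh (C e : R) : 0 <= C -> 0 < e -> exists M : nat, C / M.+1%:R <= e.
Proof.
move=> C0 e0; exists (Num.truncn (C / e)).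
have /andP[_] := truncn_itv (divr_ge0 C0 (ltW e0)).
by rewrite ltr_pdivrMr// => h; rewrite ler_pdivrMr ?ltr0n// mulrC ltW.
Qed.

End Counting.

Lemma separated_disks_disjoint (R : realType) (p q : R * R) (a b : R) (u : R * R) :
  0 < a -> 0 < b -> (a + b) ^+ 2 <= sqdist p q ->
  sqdist u p < a ^+ 2 -> sqdist u q < b ^+ 2 -> False.
Proof.
move=> a0 b0 sep up uq.
have sq w : exists2 e, 0 <= e & sqdist u w = e ^+ 2.
  by exists (Num.sqrt (sqdist u w)); rewrite ?sqrtr_ge0// sqr_sqrtr ?sqdist_ge0.
have [e e0 ee] := sq p; have [f f0 ef] := sq q.
have ea : e < a by rewrite -(@ltr_pXn2r _ 2) ?nnegrE ?(ltW a0)// -ee.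
have fb : f < b by rewrite -(@ltr_pXn2r _ 2) ?nnegrE ?(ltW b0)// -ef.
have := @sqdist_triangle _ p u q e f e0 f0.
rewrite sqdistC ee ef => /(_ (lexx _) (lexx _)) /(le_trans sep).
rewrite ler_pXn2r ?nnegrE ?addr_ge0 ?(ltW a0) ?(ltW b0)//.
by rewrite leNgt ltrD.
Qed.

(** * Area bound and disks crossing the boundary of a square *)

Section DisjointDisks.
Context {R : realType} (n : nat) (c : 'I_n -> R * R) (rr : 'I_n -> R).
Context (rr_gt0 : forall i, 0 < rr i).
Context (sep : forall i j, i != j -> (rr i + rr j) ^+ 2 <= sqdist (c i) (c j)).

(** Balls for this distance are the axis-parallel squares that replace the sets of a cover. *)
Definition supdist (p q : R * R) : R := Num.max `|p.1 - q.1| `|p.2 - q.2|.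

Lemma disks_disjoint p i j : i != j ->
  sqdist p (c i) < rr i ^+ 2 -> sqdist p (c j) < rr j ^+ 2 -> False.
Proof. by move=> ij; apply: separated_disks_disjoint => //; exact: sep. Qed.

(** Areas are compared by counting the points of a fine grid of mesh h: a disk of radius r contains
    at least r^2 / (4 h^2) of them, no point lies in two disks, and there are at most (2 L / h)^2
    points in all. *)
Lemma area_bound (P : pred 'I_n) (x : R * R) (L : R) :
  (forall i, P i -> supdist (c i) x + rr i <= L) ->
  \sum_(i | P i) rr i ^+ 2 <= 16 * L ^+ 2.
Proof.
move=> inL; have [L0|Lneg] := leP 0 L; last first.
  rewrite big_pred0; first by rewrite mulr_ge0// sqr_ge0.
  move=> i; apply/negP => /inL.
  have := rr_gt0 i; have : 0 <= supdist (c i) x by rewrite le_max normr_ge0.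
  lra.
have half_gt0 i : 0 < rr i / 2 by rewrite divr_gt0.
have [e e0 He] := finite_pos_lower_bound half_gt0.
have [M hM] := fine_mesh (mulr_ge0 (ler0n _ 2) L0) e0.
have [/eqP|Ln0] := eqVneq L 0.
  move=> /eqP L00; rewrite big_pred0; first by rewrite mulr_ge0// sqr_ge0.
  move=> i; apply/negP => /inL; rewrite L00.
  have := rr_gt0 i; have : 0 <= supdist (c i) x by rewrite le_max normr_ge0.
  lra.
have Lp : 0 < L by rewrite lt_def Ln0.
have M0 : 0 < M.+1%:R :> R by rewrite ltr0n.
set h := 2 * L / M.+1%:R.
have h0 : 0 < h by rewrite divr_gt0// mulr_gt0.
have Mh : M.+1%:R * h = 2 * L by rewrite mulrC divfK// gt_eqF.
pose X (k : 'I_M) := x.1 - L + k.+1%:R * h.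
pose Y (k : 'I_M) := x.2 - L + k.+1%:R * h.
pose inside i (k l : 'I_M) := sqdist (X k, Y l) (c i) < rr i ^+ 2.
have lower i : P i -> rr i ^+ 2 / (4 * h ^+ 2) <= \sum_k \sum_l (inside i k l)%:R.
  move=> Pi; have ri := rr_gt0 i; have := He i; have := inL i Pi; rewrite /supdist => hL he.
  have hr : h <= rr i / 2 by apply: le_trans he.
  have hL1 : - L + rr i <= (c i).1 - x.1 <= L - rr i.
    have : `|(c i).1 - x.1| <= L - rr i.
      by rewrite lerBrDr; apply: le_trans hL; rewrite lerD2r le_max lexx.
    by rewrite ler_norml => /andP[? ?]; apply/andP; split; lra.
  have hL2 : - L + rr i <= (c i).2 - x.2 <= L - rr i.
    have : `|(c i).2 - x.2| <= L - rr i.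
      by rewrite lerBrDr; apply: le_trans hL; rewrite lerD2r le_max lexx orbT.
    by rewrite ler_norml => /andP[? ?]; apply/andP; split; lra.
  (* The square of half-side 2 r / 3 lies inside the disk because 2 (2/3)^2 = 8/9 < 1. *)
  pose l := 2 / 3 * rr i.
  have lr : 1 * (rr i / (2 * h)) <= 2 * (l / h) - 1.
    rewrite mul1r /l -subr_ge0.
    have -> : 2 * (2 / 3 * rr i / h) - 1 - rr i / (2 * h) = (5 / 6 * rr i - h) / h.
      by field; rewrite gt_eqF.
    by rewrite divr_ge0 ?(ltW h0)//; lra.
  have := @grid_count_ge _ M (x.1 - L) h (c i).1 l h0.
  have := @grid_count_ge _ M (x.2 - L) h (c i).2 l h0.
  rewrite Mh /l; case/andP: hL1 => ? ?; case/andP: hL2 => ? ?.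
  move=> /(_ ltac:(lra) ltac:(lra)) c2 /(_ ltac:(lra) ltac:(lra)) c1.
  have rh0 : 0 <= rr i / (2 * h) by rewrite divr_ge0 ?mulr_ge0 ?(ltW ri) ?(ltW h0).
  rewrite mul1r in lr.
  have := ler_pM rh0 rh0 (le_trans lr c1) (le_trans lr c2).
  have -> : rr i / (2 * h) * (rr i / (2 * h)) = rr i ^+ 2 / (4 * h ^+ 2).
    by field; rewrite gt_eqF.
  move=> /le_trans; apply; rewrite mulr_suml; apply: ler_sum => k _.
  rewrite mulr_sumr; apply: ler_sum => m _.
  rewrite -natrM mulnb ler_nat; case: (boolP (_ && _)) => //.
  move=> /andP[/andP[x1 x2] /andP[y1 y2]].
  suff -> : inside i k m = true by [].
  rewrite /inside /sqdist /= /X /Y; move: x1 x2 y1 y2.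
  set u := _ - (c i).1; set v := _ - (c i).2 => x1 x2 y1 y2.
  have u2 : u ^+ 2 <= (2 / 3 * rr i) ^+ 2 by nra.
  have v2 : v ^+ 2 <= (2 / 3 * rr i) ^+ 2 by nra.
  have : 0 < rr i ^+ 2 by rewrite exprn_gt0.
  move: u2 v2; rewrite !exprMn; lra.
have h40 : 0 < 4 * h ^+ 2 by rewrite mulr_gt0// exprn_gt0.
have tot : \sum_(i | P i) rr i ^+ 2 / (4 * h ^+ 2) <= M%:R * M%:R.
  apply: (@le_trans _ _ (\sum_(i | P i) \sum_k \sum_l (inside i k l)%:R)).
    exact: ler_sum.
  rewrite exchange_big /=.
  apply: (@le_trans _ _ (\sum_(k < M) M%:R)); last first.
    by rewrite sumr_const card_ord mulr_natr.
  apply: ler_sum => k _; rewrite exchange_big /=.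
  apply: (@le_trans _ _ (\sum_(l < M) 1)); last first.
    by rewrite sumr_const card_ord.
  apply: ler_sum => l _; apply: sum_indic_le1 => i j _ _ ij; exact: disks_disjoint.
rewrite -mulr_suml ler_pdivrMr// in tot.
apply: le_trans tot _.
have -> : 16 * L ^+ 2 = (M.+1%:R * h) * (M.+1%:R * h) * 4 by rewrite Mh; ring.
have -> : M%:R * M%:R * (4 * h ^+ 2) = (M%:R * h) * (M%:R * h) * 4 by ring.
have le1 : M%:R * h <= M.+1%:R * h by rewrite ler_pM2r// ler_nat.
have Mh0 : 0 <= M%:R * h by rewrite mulr_ge0// ltW.
by rewrite ler_pM2r//; apply: ler_pM.
Qed.

(** A disk that meets the boundary of the square satisfies this condition, which for a given disk
    restricts s to an interval of length [2 * rr i]. *)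
Definition straddles (x : R * R) (s : R) (i : 'I_n) : bool :=
  s - rr i <= supdist (c i) x <= s + rr i.

(** This is 6 * 16 * 6^2: the factor 6 comes from the count of half-sides and from r^t <= 2 s0^t,
    the rest is the area bound in a square of half-side 6 s0. *)
Definition crossing_const : R := 3456.

(* The disk i straddles at most a proportion 2 rr i / s0 of the squares of
   half-side s in [s0, 2 s0], and the sum of the squared radii is bounded by
   area: so the sum is small on average over s. *)
Lemma exists_good_square (t : R) (x : R * R) (s0 : R) : 0 <= t <= 1 -> 0 < s0 ->
  exists s, [/\ s0 < s, s <= 2 * s0 &
   \sum_(i | (rr i <= 2 * s0) && straddles x s i) rr i * rr i `^ t
     <= crossing_const * (s0 * s0 `^ t)].
Proof.
move=> /andP[t0 t1] s00.
have [e e0 He] := finite_pos_lower_bound rr_gt0.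
have [M hM] := fine_mesh (ltW s00) e0.
set h := s0 / M.+1%:R.
have M0 : 0 < M.+1%:R :> R by rewrite ltr0n.
have h0 : 0 < h by rewrite divr_gt0.
have Mh : M.+1%:R * h = s0 by rewrite mulrC divfK// gt_eqF.
pose s (k : 'I_M.+1) := s0 + k.+1%:R * h.
have s_gt k : s0 < s k by rewrite /s ltrDl mulr_gt0.
have s_le k : s k <= 2 * s0.
  rewrite /s -[X in _ <= _ * X]Mh -{1}Mh mulr2n mulrDl !mul1r lerD2l.
  by rewrite ler_pM2r// ler_nat; case: k.
pose wt i := rr i * rr i `^ t.
have wt0 i : 0 <= wt i by rewrite mulr_ge0 ?powR_ge0// ltW.
pose S k := \sum_(i | (rr i <= 2 * s0) && straddles x (s k) i) wt i.
rewrite /crossing_const.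
case: (pickP [pred k | S k <= 3456 * (s0 * s0 `^ t)]) => [k /= Sk|none].
  by exists (s k); split; [exact: s_gt|exact: s_le|exact: Sk].
(* If every candidate half-side failed, the sum of [S k] over all of them would exceed the bound
   obtained by exchanging the two summations. *)
exfalso.
have big k : 3456 * (s0 * s0 `^ t) < S k.
  by rewrite ltNge; have /= -> := none k.
have : \sum_(k < M.+1) 3456 * (s0 * s0 `^ t) < \sum_(k < M.+1) S k.
  apply: ltr_sum => //; apply/hasP; exists ord0 => //; exact: mem_index_enum.
apply/negP; rewrite -leNgt sumr_const card_ord -[leRHS]mulr_natr.
(* A straddling disk of radius at most 2 s0 lies within s + 2 r <= 6 s0 of x. *)
pose P i := (rr i <= 2 * s0) && (supdist (c i) x + rr i <= 6 * s0).
have S_le k : S k <= \sum_(i | P i) wt i * (straddles x (s k) i)%:R.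
  rewrite /S big_mkcond [X in _ <= X]big_mkcond; apply: ler_sum => i _.
  rewrite /P; case: (leP (rr i) (2 * s0)) => //= r2.
  case: (boolP (straddles x (s k) i)) => [/andP[_ st]|_]; last first.
    by case: ifP => // _; rewrite mulr0.
  suff -> : supdist (c i) x + rr i <= 6 * s0 by rewrite mulr1.
  by have := s_le k; lra.
apply: le_trans (ler_sum _ (fun k _ => S_le k)) _.
rewrite exchange_big /=.
have per i : P i ->
    \sum_(k < M.+1) wt i * (straddles x (s k) i)%:R
      <= (6 / h * s0 `^ t) * rr i ^+ 2.
  move=> /andP[r2 _]; have ri := rr_gt0 i.
  rewrite -mulr_sumr.
  have cnt : \sum_(k < M.+1) (straddles x (s k) i)%:R <= 3 * (rr i / h).
    have := @grid_count_le _ M.+1 s0 h (supdist (c i) x) (rr i) h0 (ltW ri).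
    have : 1 <= rr i / h by rewrite ler_pdivlMr// mul1r; apply: le_trans (He i).
    move=> h1 h2; apply: (@le_trans _ _ (2 * (rr i / h) + 1)); last lra.
    apply: le_trans h2; apply: ler_sum => k _; rewrite ler_nat /straddles -/(s k).
    case: (boolP (_ && _)) => // /andP[g1 g2].
    have -> : (- rr i <= s k - supdist (c i) x <= rr i) = true.
      by apply/andP; split; lra.
    by [].
  apply: le_trans (ler_wpM2l (wt0 i) cnt) _.
  have rt : rr i `^ t <= 2 * s0 `^ t.
    apply: (@le_trans _ _ ((2 * s0) `^ t)).
      by apply: ler_powRl => //; exact: ltW.
    rewrite powRM ?(ltW s00)// ler_wpM2r ?powR_ge0//.
    by apply: ler1_powR => //; rewrite ler1n.
  have -> : wt i * (3 * (rr i / h)) = rr i `^ t * (3 / h * rr i ^+ 2).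
    by rewrite /wt; ring.
  have -> : 6 / h * s0 `^ t * rr i ^+ 2 = (2 * s0 `^ t) * (3 / h * rr i ^+ 2) by ring.
  by rewrite ler_wpM2r// mulr_ge0 ?sqr_ge0// divr_ge0// ltW.
apply: le_trans (ler_sum _ per) _; rewrite -mulr_sumr.
have area : \sum_(i | P i) rr i ^+ 2 <= 16 * (6 * s0) ^+ 2.
  by apply: (@area_bound P x) => i /andP[].
have coef : 0 <= 6 / h * s0 `^ t by rewrite mulr_ge0 ?powR_ge0// divr_ge0// ltW.
apply: le_trans (ler_wpM2l coef area) _.
have -> : M.+1%:R = s0 / h by rewrite -Mh mulfK// gt_eqF.
have -> : 3456 * (s0 * s0 `^ t) * (s0 / h) =
  6 / h * s0 `^ t * (16 * (6 * s0) ^+ 2) by ring.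
by [].
Qed.

End DisjointDisks.

(** * Sweeping by horizontal lines *)

Section Sweep.
Context {R : realType} (n m : nat).
Context (c : 'I_n -> R * R) (rr : 'I_n -> R) (x : 'I_m -> R * R) (ss : 'I_m -> R).
Context (rr_gt0 : forall i, 0 < rr i) (ss_gt0 : forall j, 0 < ss j).
Context (sep : forall i j, i != j -> (rr i + rr j) ^+ 2 <= sqdist (c i) (c j)).

Local Notation item := ('I_n + 'I_m)%type.
Implicit Types (it : item) (s : seq item) (y : R).

Definition size_of it : R := match it with inl i => rr i | inr j => ss j end.

Definition hits y it : bool :=
  match it with
  | inl i => - rr i < y - (c i).2 < rr i
  | inr j => - ss j < y - (x j).2 < ss j
  end.

Definition half_chord (i : 'I_n) y : R := Num.sqrt (rr i ^+ 2 - (y - (c i).2) ^+ 2).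

Definition chord y it : R * R :=
  match it with
  | inl i => ((c i).1 - half_chord i y, (c i).1 + half_chord i y)
  | inr j => ((x j).1 - ss j, (x j).1 + ss j)
  end.

Definition chords y s : seq (R * R) := [seq chord y it | it <- s & hits y it].

Lemma chords_rcons y s it :
  chords y (rcons s it) = if hits y it then rcons (chords y s) (chord y it)
                          else chords y s.
Proof. by rewrite /chords filter_rcons; case: ifP => // _; rewrite map_rcons. Qed.

Lemma mem_chords y s w : w \in chords y s ->
  exists it, [/\ it \in s, hits y it & w = chord y it].
Proof. by case/mapP => it; rewrite mem_filter => /andP[hit its ->]; exists it. Qed.

Lemma half_chord_sqr i y : hits y (inl i) ->
  half_chord i y ^+ 2 = rr i ^+ 2 - (y - (c i).2) ^+ 2 /\ 0 < half_chord i y.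
Proof.
move=> /andP[h1 h2]; have p : 0 < rr i ^+ 2 - (y - (c i).2) ^+ 2 by nra.
by rewrite sqrtr_gt0 p sqr_sqrtr// ltW.
Qed.

Lemma half_chord_le i y : half_chord i y <= rr i.
Proof.
rewrite -[leRHS]ger0_norm ?(ltW (rr_gt0 i))// -sqrtr_sqr ler_wsqrtr//.
by rewrite lerBlDr lerDl sqr_ge0.
Qed.

Lemma chord_le y it : hits y it -> (chord y it).1 <= (chord y it).2.
Proof.
case: it => [i|j] /= hit.
  by have [_] := half_chord_sqr hit; lra.
by have := ss_gt0 j; lra.
Qed.

Lemma chord_length y it : (chord y it).2 - (chord y it).1 <= 2 * size_of it.
Proof. by case: it => [i|j] /=; [have := half_chord_le i y|]; lra. Qed.

Lemma chord_end_sqdist y i : hits y (inl i) ->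
  sqdist ((chord y (inl i)).1, y) (c i) = rr i ^+ 2 /\
  sqdist ((chord y (inl i)).2, y) (c i) = rr i ^+ 2.
Proof. by move=> /half_chord_sqr[e _]; rewrite /sqdist /=; split; lra. Qed.

Lemma in_chord_sqdist y i u : hits y (inl i) ->
  (chord y (inl i)).1 < u < (chord y (inl i)).2 ->
  sqdist (u, y) (c i) < rr i ^+ 2.
Proof.
move=> /half_chord_sqr[e h0] /= /andP[h1 h2]; rewrite /sqdist /=; nra.
Qed.

Lemma in_disk_chord y i u : sqdist (u, y) (c i) < rr i ^+ 2 ->
  hits y (inl i) /\ (chord y (inl i)).1 < u < (chord y (inl i)).2.
Proof.
rewrite /sqdist /= => h; have r0 := rr_gt0 i.
have hy : - rr i < y - (c i).2 < rr i.
  rewrite -ltr_norml -(@ltr_pXn2r _ 2) ?nnegrE ?(ltW r0)// real_normK ?num_real//.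
  by have := sqr_ge0 (u - (c i).1); lra.
split => //; have [e h0] := @half_chord_sqr i y hy.
have : - half_chord i y < u - (c i).1 < half_chord i y.
  rewrite -ltr_norml -(@ltr_pXn2r _ 2) ?nnegrE ?(ltW h0)// real_normK ?num_real//.
  by rewrite e; lra.
by move=> /andP[? ?]; apply/andP; split; lra.
Qed.

Lemma open_intervals_disjoint (w w' : R * R) : w.1 < w.2 -> w'.1 < w'.2 ->
  (forall u, w.1 < u < w.2 -> w'.1 < u < w'.2 -> False) ->
  w'.2 <= w.1 \/ w.2 <= w'.1.
Proof.
move=> w12 w'12 dj; have [|h1] := leP w'.2 w.1; first by left.
have [|h2] := leP w.2 w'.1; first by right.
pose lo := Num.max w.1 w'.1; pose hi := Num.min w.2 w'.2.
have lohi : lo < hi by rewrite gt_max !lt_min w12 w'12 h1 h2.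
have a1 : w.1 <= lo by rewrite le_max lexx.
have a2 : w'.1 <= lo by rewrite le_max lexx orbT.
have a3 : hi <= w.2 by rewrite ge_min lexx.
have a4 : hi <= w'.2 by rewrite ge_min lexx orbT.
by case: (dj ((lo + hi) / 2)); apply/andP; split; lra.
Qed.

Lemma disk_chords_disjoint y i j : i != j -> hits y (inl i) -> hits y (inl j) ->
  (chord y (inl j)).2 <= (chord y (inl i)).1 \/
  (chord y (inl i)).2 <= (chord y (inl j)).1.
Proof.
move=> ij hi hj; have [_ pi] := half_chord_sqr hi; have [_ pj] := half_chord_sqr hj.
apply: open_intervals_disjoint; [move=> /=; lra|move=> /=; lra|] => u ui uj.
apply: (disks_disjoint rr_gt0 sep ij); [exact: in_chord_sqdist ui|exact: in_chord_sqdist uj].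
Qed.

Context (z : R * R) (S : R) (M : nat) (h : R) (h_gt0 : 0 < h)
  (hM : M.+1%:R * h = 2 * S).

Definition height (k : 'I_M) : R := z.2 - S + k.+1%:R * h.

Lemma height_in k : - S < height k - z.2 < S.
Proof.
have k0 : 0 < k.+1%:R * h by rewrite mulr_gt0.
have kM : k.+1%:R * h < M.+1%:R * h by rewrite ltr_pM2r// ltr_nat ltnS.
rewrite hM in kM; move: k0 kM; rewrite /height; move: (_ * h) => g g0 g1.
by apply/andP; split; lra.
Qed.

Context (t : R) (t01 : 0 < t < 1).

Definition line_sum y s : R := gap_sum t (z.1 - S) (z.1 + S) (chords y s).

(** The quantity F of the overview, for the square Q of center [z] and half-side [S] and its [M]
    interior grid lines. *)
Definition total s : R := \sum_(k < M) line_sum (height k) s.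

Let t_ge0 : 0 <= t. Proof. by case/andP: t01 => /ltW. Qed.

Lemma powR_double r : 0 <= r -> (2 * r) `^ t <= 2 * r `^ t.
Proof.
move=> r0; case/andP: t01 => t0 t1; rewrite powRM// ler_wpM2r ?powR_ge0//.
by apply: ler1_powR; rewrite ?ler1n// ltW.
Qed.

Lemma hits_count it : h <= size_of it ->
  \sum_(k < M) (hits (height k) it)%:R <= 3 * (size_of it / h) :> R.
Proof.
move=> hsz; have sz0 : 0 <= size_of it by apply: le_trans hsz; exact: ltW.
pose y2 := match it with inl i => (c i).2 | inr j => (x j).2 end.
have := grid_count_le M (z.2 - S) y2 h_gt0 sz0.
have : 1 <= size_of it / h by rewrite ler_pdivlMr// mul1r.
move=> h1 h2; apply: (@le_trans _ _ (2 * (size_of it / h) + 1)); last lra.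
apply: le_trans h2; apply: ler_sum => k _; rewrite ler_nat -/(height k).
case: (boolP (hits _ _)) => // hit.
suff -> : - size_of it <= height k - y2 <= size_of it by [].
by move: hit; case: (it) @y2 {hsz sz0 h1} => [i|j] /= /andP[? ?]; apply/andP; split; exact: ltW.
Qed.

Lemma total_not_smaller s it :
  (forall k, hits (height k) it ->
     line_sum (height k) s <= gap_sum t (z.1 - S) (z.1 + S)
                     (rcons (chords (height k) s) (chord (height k) it))) ->
  total s <= total (rcons s it).
Proof.
move=> hk; apply: ler_sum => k _; rewrite /line_sum chords_rcons.
by case: ifP => // hit; exact: hk.
Qed.

Lemma total_cost s it C : 0 <= C -> h <= size_of it ->
  (forall k, hits (height k) it ->
     line_sum (height k) s - C <= gap_sum t (z.1 - S) (z.1 + S)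
                     (rcons (chords (height k) s) (chord (height k) it))) ->
  total s - 3 * (size_of it / h) * C <= total (rcons s it).
Proof.
move=> C0 hsz hk; have cnt := ler_wpM2r C0 (hits_count hsz).
apply: (@le_trans _ _ (total s - \sum_(k < M) (hits (height k) it)%:R * C)).
  by rewrite lerB// -mulr_suml.
rewrite /total -sumrB; apply: ler_sum => k _; rewrite /line_sum chords_rcons.
by case: ifP => hit; [rewrite mul1r; exact: hk|rewrite mul0r subr0].
Qed.

Lemma near_disks_bound (P : pred 'I_n) p r : 0 < r ->
  (forall i, P i -> r <= rr i /\ sqdist (c i) p <= (rr i + 2 * r) ^+ 2) ->
  (#|P| <= 49)%N.
Proof.
move=> r0 near.
apply: (@packing_bound R #|P| (fun i => c (enum_val i)) (fun i => rr (enum_val i)) p r) => //.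
- by move=> i; have [] := near _ (enum_valP i).
- by move=> i; have [] := near _ (enum_valP i).
- by move=> i j ij; apply: sep; rewrite (inj_eq enum_val_inj).
Qed.

Definition later_than it s : Prop :=
  it \notin s /\ forall it', it' \in s -> size_of it <= size_of it'.

(** No earlier chord is strictly inside the new one: earlier disks are disjoint from the disk, and
    an earlier square has a chord of full length at least [2 * rr i]. So the power of 2 in the cost
    is 1. *)
Lemma disk_line_cost s i y : later_than (inl i) s -> hits y (inl i) ->
  line_sum y s - (2 * rr i) `^ t <=
  gap_sum t (z.1 - S) (z.1 + S) (rcons (chords y s) (chord y (inl i))).
Proof.
move=> [nin big] hit; have w12 := chord_le hit.
apply: le_trans (gap_sum_rcons_cost t01 _ _ _ w12).
rewrite lerD2l lerN2.
have -> : count (strictly_inside (chord y (inl i))) (chords y s) = 0%N.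
  apply/eqP; rewrite -leqn0 leqNgt -has_count; apply/hasPn => w /mem_chords.
  move=> [[j|j] [js hj ->]]; rewrite /strictly_inside negb_and -!leNgt; apply/orP.
  - have ij : i != j by apply: contraNneq nin => ->.
    have := chord_le hj; have := disk_chords_disjoint ij hit hj.
    by move=> [] ? ?; [left; lra|right; lra].
  - have := big _ js; have := half_chord_le i y; rewrite /=.
    case: (leP ((x j).1 - ss j) ((c i).1 - half_chord i y)) => ? ? ?; first by left.
    by right; lra.
rewrite expr0 mul1r; apply: ler_powRl => //; first by rewrite subr_ge0.
exact: chord_length.
Qed.

(** On every line hitting the disk, its chord lies in the chord of the square, already removed. *)
Lemma disk_in_square s i j : inr j \in s -> supdist (c i) (x j) + rr i < ss j ->
  total s <= total (rcons s (inl i)).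
Proof.
move=> js inside; apply: total_not_smaller => k hit.
have hx : `|(c i).1 - (x j).1| + rr i < ss j.
  by apply: le_lt_trans inside; rewrite lerD2r le_max lexx.
have hy : `|(c i).2 - (x j).2| + rr i < ss j.
  by apply: le_lt_trans inside; rewrite lerD2r le_max lexx orbT.
have hxs : `|(c i).1 - (x j).1| < ss j - rr i by rewrite ltrBrDr.
have hys : `|(c i).2 - (x j).2| < ss j - rr i by rewrite ltrBrDr.
move: hxs hys; rewrite !ltr_norml => /andP[x1 x2] /andP[y1 y2].
rewrite (@gap_sum_rcons_inside _ _ t01 _ _ _ _ (chord (height k) (inr j)))//.
- exact: chord_le.
- apply: map_f; rewrite mem_filter js andbT /=.
  by move: hit => /= /andP[? ?]; apply/andP; split; lra.
- by have := half_chord_le i (height k); rewrite /=; lra.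
- by have := half_chord_le i (height k); rewrite /=; lra.
Qed.

Lemma disk_straddling_cost s i : later_than (inl i) s -> h <= rr i ->
  total s - 6 * (rr i * rr i `^ t) / h <= total (rcons s (inl i)).
Proof.
move=> late hr; have r0 := ltW (rr_gt0 i).
have C0 : 0 <= 2 * rr i `^ t by rewrite mulr_ge0 ?powR_ge0.
have := @total_cost s (inl i) _ C0 hr.
have -> : 3 * (size_of (inl i) / h) * (2 * rr i `^ t) =
          6 * (rr i * rr i `^ t) / h by rewrite /=; ring.
apply=> k hit; apply: le_trans (disk_line_cost late hit).
by rewrite lerD2l lerN2; exact: powR_double.
Qed.

(** Chords strictly inside the chord of the square belong to disks at least as large as the square
    and close to it. By [packing_bound] there are at most 49 of them. *)
Lemma square_cost s j : uniq s -> later_than (inr j) s -> h <= ss j ->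
  total s - 6 * 2 ^+ 49 * (ss j * ss j `^ t) / h <= total (rcons s (inr j)).
Proof.
move=> us [nin big] hs; have s0 := ss_gt0 j.
have C0 : 0 <= 2 ^+ 49 * (2 * ss j `^ t).
  by apply: mulr_ge0; [exact: exprn_ge0|rewrite mulr_ge0 ?powR_ge0].
have := @total_cost s (inr j) _ C0 hs.
have -> : 3 * (size_of (inr j) / h) * (2 ^+ 49 * (2 * ss j `^ t)) =
          6 * 2 ^+ 49 * (ss j * ss j `^ t) / h.
  by rewrite /=; move: (2 ^+ 49) => K; ring.
apply=> k hit; set y := height k.
apply: le_trans (gap_sum_rcons_cost t01 _ _ _ (chord_le hit)).
rewrite lerD2l lerN2; apply: ler_pM; rewrite ?exprn_ge0 ?powR_ge0//; last first.
  apply: le_trans (powR_double (ltW s0)); apply: ler_powRl => //=; lra.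
rewrite -/y ler_eXn2l ?ltr1n//.
pose P i := (inl i \in s) && (sqdist (c i) (x j) <= (rr i + 2 * ss j) ^+ 2).
apply: (@leq_trans #|P|); last first.
  by apply: (@near_disks_bound _ (x j) (ss j)) => // i /andP[/big].
rewrite /chords count_map count_filter -size_filter cardE -(size_map (@inl 'I_n 'I_m)).
apply: uniq_leq_size; first exact: filter_uniq.
move=> it; rewrite mem_filter => /andP[/andP[/= /andP[i1 i2] hiti] its].
(* An earlier square is at least as large, so its chord is not strictly inside. *)
case: it i1 i2 hiti its => [i|j'] i1 i2 hiti its; last first.
  by have := big _ its; move: i1 i2; rewrite /=; lra.
apply: map_f; rewrite mem_enum -topredE /= /P its /=.
have [e1 _] := chord_end_sqdist hiti.
have cw := chord_le hiti.
(* A chord end inside the square is within sqrt 2 times the half-side of its center; rounding up to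
   2 matches [packing_bound]. *)
have e2 : sqdist ((chord y (inl i)).1, y) (x j) <= (2 * ss j) ^+ 2.
  have h1 : - ss j < (chord y (inl i)).1 - (x j).1 < ss j.
    by move: i1 i2 cw; rewrite /=; move=> ? ? ?; apply/andP; split; lra.
  move: hit; rewrite -/y /sqdist /= in h1 *; move: h1.
  move: (_ - (x j).1) (_ - (x j).2) => u v /andP[u1 u2] /andP[v1 v2].
  have u3 : u ^+ 2 <= ss j ^+ 2 by nra.
  have v3 : v ^+ 2 <= ss j ^+ 2 by nra.
  by rewrite exprMn; have := sqr_ge0 (ss j); lra.
rewrite sqdistC in e1; have e1' : sqdist (c i) ((chord y (inl i)).1, y) <= rr i ^+ 2.
  by rewrite e1.
by apply: sqdist_triangle e1' e2; [exact: ltW|rewrite mulr_ge0// ltW].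
Qed.

Context (d b : R) (d01 : 0 < d <= 1) (b_ge0 : 0 <= b) (bd : b ^+ 2 = 2 * d).

Definition near_disk i s : pred 'I_n :=
  [pred j | (inl j \in s) && (sqdist (c j) (c i) <= (rr j + 2 * rr i) ^+ 2)].

(** The first band surrounds the horizontal diameter, where the chord comes too close to the
    vertical tangents of the disk; the others surround the points facing a neighbour. *)
Definition bad_height i s y : bool :=
  (- (b * rr i) <= y - (c i).2 <= b * rr i) ||
  [exists j, near_disk i s j &&
     (- (b * rr i) <= y - tangent_height (c i) (rr i) (c j) <= b * rr i)].

(** There are at most 1 + 49 bands of half-width b r, each met by at most 3 b r / h lines. *)
Lemma bad_count i s : later_than (inl i) s -> h <= b * rr i ->
  \sum_(k < M) (bad_height i s (height k))%:R <= 150 * (b * rr i / h) :> R.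
Proof.
move=> [_ big] hb; have br0 : 0 <= b * rr i by rewrite mulr_ge0// ltW.
have one a : \sum_(k < M) (- (b * rr i) <= height k - a <= b * rr i)%R%:R
     <= 3 * (b * rr i / h) :> R.
  have := grid_count_le M (z.2 - S) a h_gt0 br0.
  have : 1 <= b * rr i / h by rewrite ler_pdivlMr// mul1r.
  by rewrite /height; lra.
have near : (#|near_disk i s| <= 49)%N.
  by apply: (@near_disks_bound _ (c i) (rr i)) => // j /andP[/big].
apply: (@le_trans _ _ (\sum_(k < M)
   ((- (b * rr i) <= height k - (c i).2 <= b * rr i)%R%:R +
    \sum_(j in near_disk i s)
      (- (b * rr i) <= height k - tangent_height (c i) (rr i) (c j) <= b * rr i)%R%:R))).
  apply: ler_sum => k _; rewrite /bad_height.
  case: (boolP (- _ <= height k - (c i).2 <= _)) => _ /=.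
    by rewrite lerDl sumr_ge0.
  rewrite add0r; case: existsP => [[j /andP[nj bj]]|_]; last by rewrite sumr_ge0.
  by rewrite (bigD1 j)//= bj lerDl sumr_ge0.
rewrite big_split /= exchange_big /=.
have := one (c i).2.
have : \sum_(j in near_disk i s) \sum_(k < M)
    (- (b * rr i) <= height k - tangent_height (c i) (rr i) (c j) <= b * rr i)%R%:R
    <= 147 * (b * rr i / h) :> R.
  apply: le_trans (ler_sum _ (fun j _ => one _)) _.
  rewrite sumr_const -[leLHS]mulr_natr.
  have q0 : 0 <= 3 * (b * rr i / h) by rewrite mulr_ge0// divr_ge0// ltW.
  have near' : (#|near_disk i s|%:R : R) <= 49 by rewrite ler_nat.
  have := ler_wpM2l q0 near'; lra.
lra.
Qed.

Definition clear i s := forall j, inr j \in s -> ss j + rr i < supdist (c i) (x j).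

(** Off the first band the squared half-chord is less than (1 - 2 d) r^2, hence than ((1 - d)
    r)^2. *)
Lemma good_half_chord i s y : hits y (inl i) -> ~~ bad_height i s y ->
  half_chord i y <= (1 - d) * rr i.
Proof.
move=> hit; rewrite negb_or => /andP[nb _]; have r0 := rr_gt0 i.
case/andP: (d01) => d0 d1.
have br0 : 0 <= b * rr i by rewrite mulr_ge0// ltW.
have far : (b * rr i) ^+ 2 < (y - (c i).2) ^+ 2.
  rewrite ltNge; apply: contra nb => hle; exact: ler_sqr_of.
have [e _] := half_chord_sqr hit.
have dr0 : 0 <= (1 - d) * rr i by rewrite mulr_ge0 ?subr_ge0// ltW.
rewrite -(@ler_pXn2r _ 2) ?nnegrE ?sqrtr_ge0// e exprMn.
move: far; rewrite exprMn bd => far.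
have : 0 <= d ^+ 2 * rr i ^+ 2 by rewrite mulr_ge0 ?sqr_ge0.
have -> : (1 - d) ^+ 2 * rr i ^+ 2 = rr i ^+ 2 - 2 * d * rr i ^+ 2 + d ^+ 2 * rr i ^+ 2.
  by ring.
lra.
Qed.

(** A removed square stays outside the bounding square of the disk, in which the shortened chord
    leaves a margin d r. A chord of another disk closer than d r would make the height bad by
    [near_tangency]. *)
Lemma good_separation i s y : later_than (inl i) s -> clear i s ->
  hits y (inl i) -> ~~ bad_height i s y ->
  forall w, w \in chords y s -> w.1 <= w.2 /\
    (w.2 + d * rr i <= (chord y (inl i)).1 \/
     (chord y (inl i)).2 + d * rr i <= w.1).
Proof.
move=> [nin big] cl hit good w /mem_chords [it [its hit' ->]].
split; first exact: chord_le.
have r0 := rr_gt0 i; case/andP: (d01) => d0 d1.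
have dr0 : 0 < d * rr i by rewrite mulr_gt0.
have ghc := good_half_chord hit good.
case: it its hit' => [j|j] its hit'; last first.
  have := cl _ its; rewrite /supdist lt_max => /orP[|]; rewrite ltr_normr => /orP[] hj.
  - by left; rewrite /=; lra.
  - by right; rewrite /=; lra.
  - by move: hit hit' => /= /andP[? ?] /andP[? ?]; lra.
  - by move: hit hit' => /= /andP[? ?] /andP[? ?]; lra.
have ij : i != j by apply: contraNneq nin => ->.
have bad u u' : sqdist (u, y) (c i) = rr i ^+ 2 -> sqdist (u', y) (c j) = rr j ^+ 2 ->
    - (d * rr i) <= u - u' <= d * rr i -> False.
  move=> eu eu' uu'; move: good; rewrite negb_or => /andP[_ /existsP]; apply.
  exists j; apply/andP; split; last first.
    exact: (near_tangency r0 (rr_gt0 j) b_ge0 bd (ltW d0) (sep ij) eu eu' uu').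
  (* The centers are within rr j + d rr i + rr i <= rr j + 2 rr i of each other, so the other disk
     does count as a neighbour. *)
  rewrite /near_disk /= its /=.
  have l1 : sqdist (c j) (u', y) <= rr j ^+ 2 by rewrite sqdistC eu'.
  have l2 : sqdist (u', y) (u, y) <= (d * rr i) ^+ 2.
    rewrite /sqdist /= subrr expr0n addr0 -[u' - u]opprB sqrrN.
    by move: uu'; move: (u - u') (d * rr i) => v e /andP[? ?]; nra.
  have l3 : sqdist (u, y) (c i) <= rr i ^+ 2 by rewrite eu.
  have rj := ltW (rr_gt0 j).
  have l4 := sqdist_triangle rj (ltW dr0) l1 l2.
  have rdr : 0 <= rr j + d * rr i by rewrite addr_ge0// ltW.
  have l5 := sqdist_triangle rdr (ltW r0) l4 l3.
  have dr1 : d * rr i <= rr i by rewrite ler_piMl// ltW.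
  by apply: le_trans l5 _; apply: lerXn2r; rewrite ?nnegrE; lra.
have [ei1 ei2] := chord_end_sqdist hit; have [ej1 ej2] := chord_end_sqdist hit'.
case: (disk_chords_disjoint ij hit hit') => h1.
- left; rewrite leNgt; apply/negP => h2; apply: (bad _ _ ei1 ej2).
  by apply/andP; split; lra.
- right; rewrite leNgt; apply/negP => h2; apply: (bad _ _ ei2 ej1).
  by apply/andP; split; lra.
Qed.

Lemma total_change s it (D : 'I_M -> R) :
  (forall k, hits (height k) it ->
     line_sum (height k) s + D k <= gap_sum t (z.1 - S) (z.1 + S)
                     (rcons (chords (height k) s) (chord (height k) it))) ->
  (forall k, ~~ hits (height k) it -> D k <= 0) ->
  total s + \sum_k D k <= total (rcons s it).
Proof.
move=> hk nk; rewrite /total -big_split /=; apply: ler_sum => k _.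
rewrite /line_sum chords_rcons; case: ifP => hit; first exact: hk.
by rewrite gerDl nk// hit.
Qed.

Lemma disk_outside_frame s i : S + rr i < supdist (c i) z ->
  total s <= total (rcons s (inl i)).
Proof.
move=> out; apply: total_not_smaller => k hit.
rewrite gap_sum_rcons_disj ?chord_le//.
have /andP[hk1 hk2] := height_in k; have hc := half_chord_le i (height k).
move: out hit; rewrite /supdist lt_max !ltr_normr /= => /orP[/orP[]|/orP[]] ? /andP[? ?].
- by left; lra.
- by right; lra.
- by exfalso; lra.
- by exfalso; lra.
Qed.

Context (b_small : b <= 1000^-1)
  (gain : 2^-1 <= d `^ t * (1 - 3 * (t / d))).

(** At least r/h lines hit the disk and at most 150 b r / h are bad, with b <= 1/1000, so that the
    gains on good lines outweigh the losses on bad ones. *)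
Lemma disk_inside_frame s i : later_than (inl i) s -> clear i s ->
  h <= b * rr i -> supdist (c i) z + rr i < S ->
  total s <= total (rcons s (inl i)).
Proof.
move=> late cl hb inside; have r0 := rr_gt0 i; case/andP: (d01) => d0 d1.
have hr : h <= rr i.
  apply: le_trans hb _; rewrite ler_piMl ?(ltW r0)//; have := b_small; lra.
have hx : `|(c i).1 - z.1| < S - rr i.
  by rewrite ltrBrDr; apply: le_lt_trans inside; rewrite lerD2r le_max lexx.
have hy : `|(c i).2 - z.2| < S - rr i.
  by rewrite ltrBrDr; apply: le_lt_trans inside; rewrite lerD2r le_max lexx orbT.
move: hx hy; rewrite !ltr_norml => /andP[x1 x2] /andP[y1 y2].
pose rt := rr i `^ t; have rt0 : 0 <= rt by exact: powR_ge0.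
(* A good line gains r^t / 2 and a bad one loses at most 2 r^t; the coefficient 5/2 also cancels the
   gain credited to a bad line. *)
pose D k := (hits (height k) (inl i))%:R * (2^-1 * rt)
            - (bad_height i s (height k))%:R * (5 / 2 * rt).
apply: (@le_trans _ _ (total s + \sum_k D k)); last first.
  apply: total_change => k hit; rewrite /D.
  - rewrite hit mul1r; case: (boolP (bad_height _ _ _)) => [bad|good].
      apply: le_trans (disk_line_cost late hit).
      by rewrite mul1r; have := powR_double (ltW r0); rewrite -/rt; lra.
    have ghc := good_half_chord hit good.
    rewrite mul0r subr0; apply: (@gap_sum_rcons_gain _ _ t01 _ d01) => //.
    + exact: chord_le.
    + exact: chord_length.
    + exact: good_separation.
    + by rewrite /=; lra.
    + by rewrite /=; lra.
  - by rewrite (negbTE hit) mul0r sub0r oppr_le0 mulr_ge0// mulr_ge0.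
rewrite lerDl sumrB -!mulr_suml.
have bc := bad_count late hb.
have hc : rr i / h <= \sum_(k < M) (hits (height k) (inl i))%:R.
  have := @grid_count_ge _ M (z.2 - S) h (c i).2 (rr i) h_gt0.
  rewrite hM => /(_ ltac:(lra) ltac:(lra)).
  have : 1 <= rr i / h by rewrite ler_pdivlMr// mul1r.
  by rewrite /= /height; lra.
have r20 : 0 <= 2^-1 * rt by lra.
have r50 : 0 <= 5 / 2 * rt by lra.
have h1 := ler_wpM2r r20 hc; have h2 := ler_wpM2r r50 bc.
have h3 : b * (rr i / h * rt) <= 1000^-1 * (rr i / h * rt).
  by rewrite ler_wpM2r// mulr_ge0// divr_ge0// ltW.
have h4 : 0 <= rr i / h * rt by rewrite mulr_ge0// divr_ge0// ltW.
have e : 150 * (b * rr i / h) * (5 / 2 * rt) = 375 * (b * (rr i / h * rt)).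
  by field; rewrite gt_eqF.
have e' : rr i / h * (2^-1 * rt) = 2^-1 * (rr i / h * rt) by ring.
by rewrite e in h2; rewrite e' in h1; lra.
Qed.

(** At most 3 r / h lines lose 2 (t/d) r^t each, and at most 150 b r / h bad ones lose a further 2
    r^t. This is small once b and t/d are. *)
Definition frame_loss : R := 6 * (t / d) + 300 * b.

Lemma disk_straddling_frame s i : later_than (inl i) s -> clear i s ->
  h <= b * rr i -> 2 * rr i <= S ->
  total s - frame_loss * (rr i * rr i `^ t) / h <= total (rcons s (inl i)).
Proof.
move=> late cl hb small; have r0 := rr_gt0 i; case/andP: (d01) => d0 d1.
case/andP: (t01) => t0 t1.
have hr : h <= size_of (inl i).
  apply: le_trans hb _; rewrite ler_piMl ?(ltW r0)//; have := b_small; lra.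
pose rt := rr i `^ t; have rt0 : 0 <= rt by exact: powR_ge0.
have td0 : 0 <= 2 * (t / d) * rt.
  by rewrite mulr_ge0// mulr_ge0// divr_ge0// ltW.
pose D k := - ((hits (height k) (inl i))%:R * (2 * (t / d) * rt))
            - (bad_height i s (height k))%:R * (2 * rt).
apply: (@le_trans _ _ (total s + \sum_k D k)); last first.
  apply: total_change => k hit; rewrite /D.
  - rewrite hit mul1r; case: (boolP (bad_height _ _ _)) => [bad|good].
      apply: le_trans (disk_line_cost late hit).
      by rewrite mul1r; have := powR_double (ltW r0); rewrite -/rt; lra.
    have ghc := good_half_chord hit good.
    have dr1 : d * rr i <= rr i by rewrite ler_piMl// ltW.
    rewrite mul0r subr0; apply: (@gap_sum_rcons_loss _ _ t01 _ d01) => //.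
    + exact: chord_le.
    + exact: chord_length.
    + exact: good_separation.
    (* As 2 r <= S, the disk cannot be close to both vertical sides of Q. *)
    + rewrite /=; case: (leP (z.1 - S + d * rr i) ((c i).1 - half_chord i (height k))).
        by left.
      by move=> ?; right; lra.
  - by rewrite (negbTE hit) mul0r oppr0 sub0r oppr_le0 mulr_ge0// mulr_ge0.
rewrite lerD2l sumrB sumrN -!mulr_suml.
have bc := bad_count late hb; have hc := hits_count hr.
have r20 : 0 <= 2 * rt by lra.
have h1 := ler_wpM2r td0 hc; have h2 := ler_wpM2r r20 bc.
have e : frame_loss * (rr i * rt) / h =
  3 * (size_of (inl i) / h) * (2 * (t / d) * rt) + 150 * (b * rr i / h) * (2 * rt).
  by rewrite /frame_loss /=; ring.
rewrite -/rt e; lra.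
Qed.

(** A bound for h times the decrease of [total]. A straddling disk is charged to the boundary of Q
    and to the squares at least as large as itself, so that the charges can later be summed boundary
    by boundary. *)
Definition loss it : R :=
  match it with
  | inl i => (if straddles c rr z S i then frame_loss * (rr i * rr i `^ t) else 0)
     + \sum_j (if (rr i <= ss j) && straddles c rr (x j) (ss j) i
               then 6 * (rr i * rr i `^ t) else 0)
  | inr j => 6 * 2 ^+ 49 * (ss j * ss j `^ t)
  end.

Context (h_disk : forall i, h <= b * rr i) (h_square : forall j, h <= ss j).

Lemma insert_item s it : uniq s -> later_than it s -> 2 * size_of it <= S ->
  total s - loss it / h <= total (rcons s it).
Proof.
case: it => [i|j] us late small; last exact: square_cost.
have r0 := rr_gt0 i; case/andP: (d01) => d0 d1; case/andP: (t01) => t0 t1.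
have wt0 : 0 <= rr i * rr i `^ t by rewrite mulr_ge0 ?powR_ge0// ltW.
have fl0 : 0 <= frame_loss.
  apply: addr_ge0; apply: mulr_ge0; rewrite ?ler0n//.
  by apply: divr_ge0; exact: ltW.
have hr : h <= rr i.
  apply: le_trans (h_disk i) _; rewrite ler_piMl ?(ltW r0)//; have := b_small; lra.
have sq0 j : 0 <= if (rr i <= ss j) && straddles c rr (x j) (ss j) i
               then 6 * (rr i * rr i `^ t) else 0.
  by case: ifP => // _; rewrite mulr_ge0.
have fr0 : 0 <= if straddles c rr z S i then frame_loss * (rr i * rr i `^ t) else 0.
  by case: ifP => // _; rewrite mulr_ge0.
have loss_ge a : a <= loss (inl i) -> total s - a / h <= total (rcons s (inl i)) ->
    total s - loss (inl i) / h <= total (rcons s (inl i)).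
  by move=> al; apply: le_trans; rewrite lerD2l lerN2 ler_pM2r ?invr_gt0.
have no_loss : total s <= total (rcons s (inl i)) ->
    total s - loss (inl i) / h <= total (rcons s (inl i)).
  move=> le; apply: (@loss_ge 0); last by rewrite mul0r subr0.
  by rewrite /loss addr_ge0// sumr_ge0.
(* Four positions of a disk remain after the case where it touches a removed square is split into
   inside and straddling: these two, then, away from all removed squares, outside Q, inside Q or
   straddling its boundary. *)
have [[j [js dj]]|cl] := pselect (exists j, inr j \in s /\
    supdist (c i) (x j) <= ss j + rr i).
  have rs : rr i <= ss j by have [_ /(_ _ js)] := late.
  have [inside|nin] := ltP (supdist (c i) (x j) + rr i) (ss j).
    exact/no_loss/(disk_in_square js).
  apply: (loss_ge _ _ (disk_straddling_cost late hr)).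
  have st : straddles c rr (x j) (ss j) i by rewrite /straddles lerBlDr nin dj.
  rewrite /loss (bigD1 j)//= rs st /=.
  by rewrite addrCA lerDl addr_ge0// sumr_ge0.
have clr : clear i s.
  move=> j js; rewrite ltNge; apply/negP => le; apply: cl; by exists j.
have [out|nout] := ltP (S + rr i) (supdist (c i) z).
  exact/no_loss/disk_outside_frame.
have [inside|nin] := ltP (supdist (c i) z + rr i) S.
  exact/no_loss/disk_inside_frame.
apply: (loss_ge _ _ (disk_straddling_frame late clr (h_disk i) small)).
have st : straddles c rr z S i by rewrite /straddles lerBlDr nin nout.
by rewrite /loss st lerDl sumr_ge0.
Qed.

Lemma insert_items s1 s2 : uniq (s1 ++ s2) ->
  pairwise (fun it it' => size_of it' <= size_of it) (s1 ++ s2) ->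
  (forall it, it \in s2 -> 2 * size_of it <= S) ->
  total s1 - (\sum_(it <- s2) loss it) / h <= total (s1 ++ s2).
Proof.
elim: s2 s1 => [|it s2 IH] s1 us pw small.
  by rewrite big_nil mul0r subr0 cats0.
have late : later_than it s1.
  split.
    by move: us; rewrite -cat_rcons cat_uniq rcons_uniq => /andP[/andP[]].
  move=> it' it's1; move: pw; rewrite pairwise_cat => /andP[/allrelP ar _].
  by apply: ar => //; rewrite mem_head.
have u1 : uniq s1 by move: us; rewrite cat_uniq => /andP[].
have := insert_item u1 late (small _ (mem_head _ _)).
rewrite big_cons mulrDl.
have : total (rcons s1 it) - (\sum_(j <- s2) loss j) / h <= total (rcons s1 it ++ s2).
  apply: IH; rewrite ?cat_rcons// => it' it's2.
  by apply: small; rewrite inE it's2 orbT.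
rewrite cat_rcons; lra.
Qed.

Lemma total_covered s : (forall p, supdist p z <= S ->
    (exists2 i, inl i \in s & sqdist p (c i) < rr i ^+ 2) \/
    (exists2 j, inr j \in s & supdist p (x j) < ss j)) ->
  total s = 0.
Proof.
move=> cov; apply: big1 => k _; apply: gap_sum_covered => // u /andP[u1 u2].
have /andP[hk1 hk2] := height_in k.
have inS : supdist (u, height k) z <= S.
  by rewrite /supdist ge_max !ler_norml /=; apply/andP; split; apply/andP; split; lra.
have [[i iins pi]|[j js]] := cov _ inS.
  have [hit uc] := in_disk_chord pi.
  by exists (chord (height k) (inl i)) => //; apply: map_f; rewrite mem_filter hit iins.
rewrite /supdist gt_max !ltr_norml /= => /andP[/andP[a1 a2] /andP[a3 a4]].
exists (chord (height k) (inr j)); last by apply/andP; split; rewrite /=; lra.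
by apply: map_f; rewrite mem_filter js andbT; apply/andP.
Qed.

(** The square of half-side rho/2 around z lies in the free disk: at least rho / (2 h) lines cross
    it, each along an untouched interval of length rho. *)
Lemma total_free_disk s rho : 0 < rho -> rho <= S -> 2 * h <= rho ->
  (forall it, it \in s ->
     exists2 i, it = inl i & (rr i + rho) ^+ 2 <= sqdist (c i) z) ->
  rho * rho `^ t / 2 / h <= total s.
Proof.
move=> rho0 rhoS hrho free.
have cnt : rho / 2 / h <= \sum_(k < M) (- (rho / 2) < height k - z.2 < rho / 2)%R%:R.
  have := @grid_count_ge _ M (z.2 - S) h z.2 (rho / 2) h_gt0.
  rewrite hM => /(_ ltac:(lra) ltac:(lra)).
  have : 1 <= rho / 2 / h by rewrite ler_pdivlMr// mul1r; lra.
  by rewrite /height; lra.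
have rt0 : 0 <= rho `^ t by exact: powR_ge0.
have -> : rho * rho `^ t / 2 / h = rho / 2 / h * rho `^ t by ring.
apply: le_trans (ler_wpM2r rt0 cnt) _; rewrite mulr_suml; apply: ler_sum => k _.
case: (boolP (_ && _)) => [/andP[k1 k2]|_]; last by rewrite mul0r gap_sum_ge0.
rewrite mul1r.
have -> : rho = (z.1 + rho / 2) - (z.1 - rho / 2) by field.
apply: gap_sum_ge_interval => //; [lra|lra|lra|] => w /mem_chords [it [its hit ->]].
split; first exact: chord_le.
have [i eit far] := free _ its; subst it.
have [_ hc] := half_chord_sqr hit.
apply: (@open_intervals_disjoint (z.1 - rho / 2, z.1 + rho / 2)) => /=; [lra|lra|].
move=> u /andP[u1 u2] /(in_chord_sqdist hit) hi.
have hz : sqdist (u, height k) z < rho ^+ 2.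
  rewrite /sqdist /=; move: (height k - z.2) k1 k2 => v v1 v2.
  have : -(rho / 2) < u - z.1 < rho / 2 by apply/andP; split; lra.
  move: (u - z.1) => a /andP[a1 a2].
  have a3 : a ^+ 2 <= (rho / 2) ^+ 2 by nra.
  have v3 : v ^+ 2 <= (rho / 2) ^+ 2 by nra.
  have : 0 < rho ^+ 2 by rewrite exprn_gt0.
  by move: a3 v3; rewrite !expr_div_n; lra.
exact: (@separated_disks_disjoint _ (c i) z (rr i) rho (u, height k)).
Qed.

End Sweep.

(** * Finite covers *)

Section FiniteCovers.
Context {R : realType}.

(** The parameters form a hierarchy: b is small, d is of order b^2 by tangency, and t is small
    compared with d. The last condition keeps the loss along the boundary of Q below half of the
    initial value of F. *)
Definition admissible (t d b : R) : Prop :=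
  [/\ 0 < t < 1, 0 < d <= 1, 0 < b <= 1000^-1, b ^+ 2 = 2 * d &
      2^-1 <= d `^ t * (1 - 3 * (t / d)) /\
      4 * crossing_const * frame_loss t d b <= 4^-1].

(** Items larger than [rho] are inserted first; they are disks avoiding the free disk, so [total] is
    still large. The remaining items bring it down to 0, and their losses must account for the
    difference. *)
Lemma sweep_inequality (n m : nat) (c : 'I_n -> R * R) (rr : 'I_n -> R)
    (x : 'I_m -> R * R) (ss : 'I_m -> R) (z : R * R) (S rho t d b : R) :
  (forall i, 0 < rr i) -> (forall j, 0 < ss j) ->
  (forall i j, i != j -> (rr i + rr j) ^+ 2 <= sqdist (c i) (c j)) ->
  admissible t d b -> 0 < rho -> 2 * rho <= S -> (forall j, ss j <= rho) ->
  (forall i, rho < rr i -> (rr i + rho) ^+ 2 <= sqdist (c i) z) ->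
  (forall p, supdist p z <= S -> (exists i, sqdist p (c i) < rr i ^+ 2) \/
                                 (exists j, supdist p (x j) < ss j)) ->
  rho * rho `^ t / 2 <=
    \sum_(i | (rr i <= rho) && straddles c rr z S i)
       frame_loss t d b * (rr i * rr i `^ t)
  + \sum_j (\sum_(i | (rr i <= ss j) && straddles c rr (x j) (ss j) i)
               6 * (rr i * rr i `^ t)
            + 6 * 2 ^+ 49 * (ss j * ss j `^ t)).
Proof.
move=> rr0 ss0 sep adm rho0 rhoS ssrho far cov.
have [t01 d01 /andP[b0 _] bd [gain _]] := adm.
have S0 : 0 <= S by lra.
have br0 i : 0 < b * rr i by rewrite mulr_gt0.
have [e e0 He] := finite_pos_lower_bound br0.
have [f f0 Hf] := finite_pos_lower_bound ss0.
(* The mesh must be fine with respect to the bands of bad lines, the squares and the free disk. *)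
pose g := Num.min (Num.min e f) (rho / 2).
have g0 : 0 < g by rewrite !lt_min e0 f0 divr_gt0.
have [M hM] := fine_mesh (mulr_ge0 (ler0n _ 2) S0) g0.
set h := 2 * S / M.+1%:R in hM.
have M0 : 0 < M.+1%:R :> R by rewrite ltr0n.
have h0 : 0 < h by rewrite divr_gt0// mulr_gt0//; lra.
have Mh : M.+1%:R * h = 2 * S by rewrite mulrC divfK// gt_eqF.
move: hM; rewrite !le_min => /andP[/andP[he hf] hr].
have h_disk i : h <= b * rr i by apply: le_trans he (He i).
have h_square j : h <= ss j by apply: le_trans hf (Hf j).
pose sz := size_of rr ss.
pose leS it it' := sz it' <= sz it.
pose s := sort leS (enum {: 'I_n + 'I_m}).
have us : uniq s by rewrite sort_uniq enum_uniq.
have ins it : it \in s by rewrite mem_sort mem_enum.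
have leS_trans : transitive leS by move=> u v w vu uw; exact: le_trans uw vu.
have pws : pairwise leS s.
  by rewrite -(sorted_pairwise leS_trans); apply: sort_sorted => u v; exact: le_total.
pose s1 := [seq it <- s | rho < sz it].
pose s2 := [seq it <- s | ~~ (rho < sz it)].
have u12 : uniq (s1 ++ s2).
  rewrite cat_uniq !filter_uniq//= andbT -all_predC; apply/allP => it.
  by rewrite mem_filter => /andP[nb _] /=; rewrite mem_filter (negbTE nb).
have pw12 : pairwise leS (s1 ++ s2).
  rewrite pairwise_cat !pairwise_filter// !andbT; apply/allrelP => it it'.
  rewrite !mem_filter -leNgt => /andP[h1 _] /andP[h2 _]; rewrite /leS.
  exact: le_trans h2 (ltW h1).
have in12 it : it \in s1 ++ s2.
  by rewrite mem_cat !mem_filter ins !andbT; case: (_ < _).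
have small2 it : it \in s2 -> 2 * size_of rr ss it <= S.
  by rewrite mem_filter -leNgt => /andP[h1 _]; rewrite -/sz; lra.
have b1 : b <= 1000^-1 by case: adm => _ _ /andP[].
have := @insert_items R n m c rr x ss rr0 ss0 sep z S M h h0 Mh t t01 d b d01
  (ltW b0) bd b1 gain h_disk h_square s1 s2 u12 pw12 small2.
clear b1.
rewrite [X in _ <= X]total_covered//; last first.
  by move=> p /cov[[i pi]|[j pj]]; [left; exists i|right; exists j].
have := @total_free_disk R n m c rr x ss rr0 ss0 z S M h h0 Mh t t01 s1 rho rho0.
move=> /(_ ltac:(lra) ltac:(lra)).
have free it : it \in s1 ->
    exists2 i, it = inl i & (rr i + rho) ^+ 2 <= sqdist (c i) z.
  rewrite mem_filter => /andP[big _]; case: it big => [i|j] big.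
    by exists i => //; exact: far.
  by exfalso; have := ssrho j; rewrite leNgt => /negP; apply.
move=> /(_ free) lower upper.
have {lower upper} : rho * rho `^ t / 2 / h <=
    (\sum_(it <- s2) loss c rr x ss z S t d b it) / h by lra.
rewrite ler_pM2r ?invr_gt0// => /le_trans; apply.
rewrite big_filter (perm_big (enum {: 'I_n + 'I_m})) ?perm_sort//=.
rewrite big_enum_cond big_sumType /=.
have t_ge0 : 0 <= t by case/andP: t01 => /ltW.
have wt0 i : 0 <= rr i * rr i `^ t by rewrite mulr_ge0 ?powR_ge0// ltW.
rewrite [X in X + _ <= _]big_split /= -big_mkcondr /= [X in _ <= _ + X]big_split /=.
rewrite exchange_big /= -!addrA.
apply: lerD; last apply: lerD.
- rewrite [leLHS]big_mkcond [leRHS]big_mkcond; apply: ler_sum => i _.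
  by rewrite -leNgt.
- apply: ler_sum => j _; rewrite [leRHS]big_mkcond [leLHS]big_mkcond /=.
  apply: ler_sum => i _; case: ifP => // _; case: ifP => // _.
  by rewrite mulr_ge0.
- rewrite [leLHS]big_mkcond /=; apply: ler_sum => j _; case: ifP => // _.
  apply: mulr_ge0; last by rewrite mulr_ge0 ?powR_ge0// ltW.
  by apply: mulr_ge0; last exact: exprn_ge0.
Qed.

(** Bernoulli's inequality applied to d^-1 = 1 + (d^-1 - 1) gives d^(-t) <= 1 + t/d, a bound in
    terms of t/d alone. *)
Lemma powR_inv_bound (t d : R) : 0 < t < 1 -> 0 < d <= 1 ->
  (1 + t / d)^-1 <= d `^ t.
Proof.
move=> t01 /andP[d0 d1]; case/andP: (t01) => t0 t1.
have td0 : 0 < 1 + t / d by rewrite addr_gt0// divr_gt0.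
have id : 1 <= d^-1 by rewrite -invr1 lef_pV2 ?posrE.
have id0 : 0 <= d^-1 - 1 by rewrite subr_ge0.
have := powR_bernoulli t01 id0.
have -> : 1 + (d^-1 - 1) = d^-1 by ring.
have -> : d^-1 `^ t = (d `^ t)^-1.
  by rewrite -(powR_inv1 (ltW d0)) -powRrM mulN1r powRN.
move=> h; rewrite -[leRHS]invrK lef_pV2 ?posrE ?invr_gt0 ?powR_gt0//.
by apply: le_trans h _; rewrite lerD2l ler_pM2l//; lra.
Qed.

Lemma exists_admissible : exists t d b : R, admissible t d b.
Proof.
pose q : R := 1000^-1.
have q0 : 0 < q by rewrite invr_gt0 ltr0n.
have q1000 : 1000 * q = 1 by apply: divff; rewrite pnatr_eq0.
have q1 : q <= 1000^-1 by exact: lexx.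
have q2 : 0 < q ^+ 2 <= q / 1000.
  by rewrite exprn_gt0//= expr2 lexx.
(* With t/d = q^2, the gain condition follows from (1 - 3 q^2) / (1 + q^2) >= 1/2, and the frame
   condition from 4 * 3456 * (6 q^2 + 300 q^3) < 1/4. *)
pose b := q ^+ 3; pose d := b ^+ 2 / 2; pose t := d * q ^+ 2.
have b0 : 0 < b by rewrite exprn_gt0.
have q21 : q ^+ 2 <= 1000^-1 by case/andP: q2 => _; lra.
have bq : b <= q ^+ 2 / 1000.
  by rewrite /b exprSr lexx.
have b1 : b <= 1000^-1 by lra.
have d0 : 0 < d by rewrite divr_gt0// exprn_gt0.
have d1 : d <= 1.
  have : b ^+ 2 <= 1 by rewrite expr_le1 ?(ltW b0)//; lra.
  by rewrite /d; lra.
have td : t / d = q ^+ 2 by rewrite /t mulrC mulKf// gt_eqF.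
have t0 : 0 < t by rewrite mulr_gt0//; case/andP: q2.
have t1 : t < 1.
  have : t <= q ^+ 2 by rewrite /t ler_piMl//; case/andP: q2 => /ltW.
  lra.
have t01 : 0 < t < 1 by rewrite t0.
have d01 : 0 < d <= 1 by rewrite d0.
exists t, d, b; split => //.
- by rewrite b0.
- by rewrite /d mulrC divfK.
split.
- rewrite td; have := powR_inv_bound t01 d01; rewrite td => h.
  have p0 : 0 <= 1 - 3 * q ^+ 2 by lra.
  apply: le_trans (ler_wpM2r p0 h).
  case/andP: q2 => q20 _.
  by rewrite [leRHS]mulrC ler_pdivlMr; lra.
- rewrite /crossing_const /frame_loss td; case/andP: q2 => q20 q22.
  have : q ^+ 2 <= 1000^-1 * 1000^-1 by rewrite expr2.
  lra.
Qed.

(** The half-sides at most double when they are averaged, which multiplies their powers by at most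
    4, whence 24 = 6 * 4. The outer 4 comes from 1/2 - 1/4, the part of the initial value not lost
    along the boundary of Q. *)
Definition cover_const : R := 4 * (6 * crossing_const + 24 * 2 ^+ 49).

(** All half-sides are chosen by [exists_good_square]: that of Q in ]2 rho, 4 rho], that of the
    square j in ]e j, 2 e j]. This bounds the charges on each boundary. *)
Lemma finite_cover_bound (t d b : R) : admissible t d b ->
  forall (n m : nat) (c : 'I_n -> R * R) (rr : 'I_n -> R)
    (x : 'I_m -> R * R) (e : 'I_m -> R) (z : R * R) (rho : R),
  (forall i, 0 < rr i) -> (forall j, 0 < e j) ->
  (forall i j, i != j -> (rr i + rr j) ^+ 2 <= sqdist (c i) (c j)) ->
  0 < rho -> (forall j, 2 * e j <= rho) ->
  (forall i, rho < rr i -> (rr i + rho) ^+ 2 <= sqdist (c i) z) ->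
  (forall p, supdist p z <= 4 * rho ->
     (exists i, sqdist p (c i) < rr i ^+ 2) \/ (exists j, supdist p (x j) < e j)) ->
  rho * rho `^ t <= cover_const * \sum_j e j * e j `^ t.
Proof.
move=> adm n m c rr x e z rho rr0 e0 sep rho0 erho far cov.
have [t01 /andP[d0 _] /andP[b0 _] _ [_ fl]] := adm.
case/andP: (t01) => t0 t1.
have t01' : 0 <= t <= 1 by rewrite !ltW.
have fl0 : 0 <= frame_loss t d b.
  apply: addr_ge0; apply: mulr_ge0; rewrite ?ler0n ?(ltW b0)//.
  by apply: divr_ge0; exact: ltW.
have good (y : R * R) s0 := @exists_good_square R n c rr rr0 sep t y s0 t01'.
have C0 : 0 <= @crossing_const R by rewrite ler0n.
have K0 : 0 <= 2 ^+ 49 :> R by exact: exprn_ge0.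
have sweep := fun S ss ss0 => @sweep_inequality n m c rr x ss z S rho t d b rr0 ss0 sep adm.
rewrite /cover_const.
move: (@crossing_const R) C0 fl good => C C0 fl good.
move: (2 ^+ 49) K0 sweep => K K0 sweep.
move: (frame_loss t d b) fl fl0 sweep => F fl F0 sweep.
clear adm b0 d0.
have wt0 i : 0 <= rr i * rr i `^ t by rewrite mulr_ge0 ?powR_ge0// ltW.
have pow2 r : 0 <= r -> 2 * r * (2 * r) `^ t <= 4 * (r * r `^ t).
  move=> r0; have := powR_double t01 r0 => h.
  have r20 : 0 <= 2 * r by rewrite mulr_ge0.
  by have := ler_wpM2l r20 h; lra.
have rho2 : 0 < 2 * rho by rewrite mulr_gt0.
have [S [S1 S2 HS]] := good z _ rho2.
have /choice [ss Hss] : forall j, exists s, [/\ e j < s, s <= 2 * e j &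
   \sum_(i | (rr i <= 2 * e j) && straddles c rr (x j) s i) rr i * rr i `^ t
     <= C * (e j * e j `^ t)].
  by move=> j; exact: good.
have ss0 j : 0 < ss j by have [h _ _] := Hss j; exact: lt_trans (e0 j) h.
have rhoS : 2 * rho <= S by exact: ltW.
have ssrho j : ss j <= rho by have [_ h _] := Hss j; exact: le_trans h (erho j).
have cov' p : supdist p z <= S -> (exists i, sqdist p (c i) < rr i ^+ 2) \/
                                 (exists j, supdist p (x j) < ss j).
  move=> pS; have p4 : supdist p z <= 4 * rho by lra.
  have [?|[j pj]] := cov p p4; [by left|right; exists j].
  by have [h _ _] := Hss j; exact: lt_trans pj h.
have {sweep} := sweep S ss ss0 rho0 rhoS ssrho far cov'.
have sub_le (P Q : pred 'I_n) : (forall i, P i -> Q i) ->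
    \sum_(i | P i) rr i * rr i `^ t <= \sum_(i | Q i) rr i * rr i `^ t.
  move=> PQ; rewrite [leLHS]big_mkcond [leRHS]big_mkcond; apply: ler_sum => i _.
  case: (boolP (P i)) => [/PQ ->//|_]; by case: ifP.
have frame : \sum_(i | (rr i <= rho) && straddles c rr z S i)
    F * (rr i * rr i `^ t) <= 4^-1 * (rho * rho `^ t).
  rewrite -mulr_sumr.
  have h1 : \sum_(i | (rr i <= rho) && straddles c rr z S i) rr i * rr i `^ t
      <= 4 * C * (rho * rho `^ t).
    apply: (@le_trans _ _ (C * (2 * rho * (2 * rho) `^ t))).
      apply: le_trans HS; apply: sub_le => i /andP[h ->]; rewrite andbT; lra.
    by have := ler_wpM2l C0 (pow2 _ (ltW rho0)); lra.
  apply: le_trans (ler_wpM2l F0 h1) _.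
  have rt0 : 0 <= rho * rho `^ t by rewrite mulr_ge0 ?powR_ge0// ltW.
  by have := ler_wpM2r rt0 fl; lra.
have squares : \sum_j (\sum_(i | (rr i <= ss j) && straddles c rr (x j) (ss j) i)
               6 * (rr i * rr i `^ t) + 6 * K * (ss j * ss j `^ t))
    <= (6 * C + 24 * K) * \sum_j e j * e j `^ t.
  rewrite mulr_sumr; apply: ler_sum => j _; have [h1 h2 h3] := Hss j.
  have a1 : \sum_(i | (rr i <= ss j) && straddles c rr (x j) (ss j) i)
               6 * (rr i * rr i `^ t) <= 6 * C * (e j * e j `^ t).
    rewrite -mulr_sumr.
    have : \sum_(i | (rr i <= ss j) && straddles c rr (x j) (ss j) i)
       rr i * rr i `^ t <= C * (e j * e j `^ t).
      apply: le_trans h3; apply: sub_le => i /andP[h ->]; rewrite andbT.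
      exact: le_trans h h2.
    lra.
  have a2 : ss j * ss j `^ t <= 4 * (e j * e j `^ t).
    apply: le_trans (pow2 _ (ltW (e0 j))); apply: ler_pM; rewrite ?powR_ge0 ?(ltW (ss0 j))//.
    by apply: ler_powRl; rewrite ?(ltW t0) ?(ltW (ss0 j)).
  by have := ler_wpM2l K0 a2; lra.
lra.
Qed.

End FiniteCovers.

(** * A disk free of larger disks *)

Section FreeDisk.
Context {R : realType}.
Implicit Types (p z : R * R).

(** Otherwise the point dividing the segment of centers in the ratio a : b lies in both disks. *)
Lemma disjoint_disks_separated (p q : R * R) (a b : R) : 0 < a -> 0 < b ->
  (forall u, sqdist u p < a ^+ 2 -> sqdist u q < b ^+ 2 -> False) ->
  (a + b) ^+ 2 <= sqdist p q.
Proof.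
move=> a0 b0 dj; rewrite leNgt; apply/negP => close.
have ab0 : 0 < a + b by rewrite addr_gt0.
have scale (e : R) : 0 < e -> (e / (a + b)) ^+ 2 * sqdist p q < e ^+ 2.
  move=> e0; have -> : e ^+ 2 = (e / (a + b)) ^+ 2 * (a + b) ^+ 2.
    by rewrite -exprMn divfK// gt_eqF.
  by rewrite ltr_pM2l// exprn_gt0// divr_gt0.
pose l := a / (a + b).
have l1 : 1 - l = b / (a + b) by rewrite /l; field; rewrite gt_eqF.
apply: (dj (p.1 + l * (q.1 - p.1), p.2 + l * (q.2 - p.2))).
- have -> : sqdist (p.1 + l * (q.1 - p.1), p.2 + l * (q.2 - p.2)) p
      = l ^+ 2 * sqdist p q by rewrite /sqdist /=; ring.
  exact: scale.
- have -> : sqdist (p.1 + l * (q.1 - p.1), p.2 + l * (q.2 - p.2)) q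
      = (1 - l) ^+ 2 * sqdist p q by rewrite /sqdist /=; ring.
  by rewrite l1; exact: scale.
Qed.

Lemma common_bound (T : eqType) (l : seq T) (P : T -> R -> Prop) :
  (forall i, i \in l -> exists2 e, 0 < e & forall u, 0 < u <= e -> P i u) ->
  exists2 e, 0 < e & forall i, i \in l -> forall u, 0 < u <= e -> P i u.
Proof.
elim: l => [|i l IH] h; first by exists 1.
have [|e e0 He] := IH; first by move=> j jl; apply: h; rewrite inE jl orbT.
have [f f0 Hf] := h i (mem_head _ _).
exists (Num.min e f); first by rewrite lt_min e0.
move=> j; rewrite inE => /orP[/eqP ->|jl] u; rewrite le_min => /andP[u0 /andP[ue uf]].
- by apply: Hf; rewrite u0.
- by apply: He => //; rewrite u0.
Qed.

(* The cross product of the radii at a common boundary point p vanishes, by the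
   equality case of Cauchy-Schwarz. *)
Lemma tangent_normals_parallel (p c c' : R * R) (r r' : R) : 0 < r -> 0 < r' ->
  (r + r') ^+ 2 <= sqdist c c' -> sqdist p c = r ^+ 2 -> sqdist p c' = r' ^+ 2 ->
  (p.1 - c.1) * (p.2 - c'.2) = (p.2 - c.2) * (p.1 - c'.1).
Proof.
move=> r0 r'0 sep pc pc'.
have e : sqdist c c' = sqdist p c + sqdist p c'
  - 2 * ((p.1 - c.1) * (p.1 - c'.1) + (p.2 - c.2) * (p.2 - c'.2)).
  by rewrite /sqdist; ring.
set dot := _ + (p.2 - c.2) * _ in e.
have rr'0 : 0 < r * r' by rewrite mulr_gt0.
have h1 : dot <= - (r * r').
  by move: sep; rewrite e pc pc' sqrrD; lra.
have h2 : (r * r') ^+ 2 <= dot ^+ 2 by nra.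
have lagrange : sqdist p c * sqdist p c' = dot ^+ 2 +
   ((p.1 - c.1) * (p.2 - c'.2) - (p.2 - c.2) * (p.1 - c'.1)) ^+ 2.
  by rewrite /sqdist /dot; ring.
apply/eqP; rewrite -subr_eq0 -sqrf_eq0 eq_le sqr_ge0 andbT.
by move: lagrange h2; rewrite pc pc' exprMn; lra.
Qed.

(** The disks having x0 on their boundary share a tangent line there. A small move along it leaves
    all of their closures, and stays away from the finitely many other disks of [l]. *)
Lemma free_disk_finite (c : nat -> R * R) (r : nat -> R) (x0 : R * R)
    (l : seq nat) (e : R) :
  (forall i, 0 < r i) ->
  (forall i j, i != j -> (r i + r j) ^+ 2 <= sqdist (c i) (c j)) ->
  (forall i, r i ^+ 2 <= sqdist x0 (c i)) -> 0 < e ->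
  exists z rho, [/\ sqdist x0 z <= e ^+ 2, 0 < rho, rho <= e &
    forall i, i \in l -> (r i + rho) ^+ 2 <= sqdist (c i) z].
Proof.
move=> r0 sep out e0.
have [v [v0 vP]] : exists v : R * R, 0 < v.1 ^+ 2 + v.2 ^+ 2 /\
    forall i, sqdist x0 (c i) = r i ^+ 2 ->
      v.1 * (x0.1 - (c i).1) + v.2 * (x0.2 - (c i).2) = 0.
  have [[i0 ti0]|none] := pselect (exists i, sqdist x0 (c i) = r i ^+ 2); last first.
    exists (1, 0); split=> [|i ti]; first by rewrite /= expr1n expr0n addr0.
    by case: none; exists i.
  (* The normal at x0 turned by a right angle; the normals of the other disks through x0 are
     parallel. *)
  exists (- (x0.2 - (c i0).2), x0.1 - (c i0).1); split=> [|i ti] /=.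
    have := ti0; rewrite /sqdist sqrrN addrC => ->; exact: exprn_gt0.
  have [->|ii0] := eqVneq i i0; first by ring.
  rewrite eq_sym in ii0.
  by have := tangent_normals_parallel (r0 i0) (r0 i) (sep _ _ ii0) ti0 ti; lra.
set V := v.1 ^+ 2 + v.2 ^+ 2 in v0.
pose pt (u : R) := (x0.1 + u * v.1, x0.2 + u * v.2).
have ptE u i : sqdist (c i) (pt u) = sqdist x0 (c i) +
    2 * u * (v.1 * (x0.1 - (c i).1) + v.2 * (x0.2 - (c i).2)) + u ^+ 2 * V.
  by rewrite /sqdist /pt /V /=; ring.
have /common_bound [e1 e10 He1] : forall i, i \in l ->
    exists2 f, 0 < f & forall u, 0 < u <= f -> r i ^+ 2 < sqdist (c i) (pt u).
  move=> i _; case: (eqVneq (sqdist x0 (c i)) (r i ^+ 2)) => [ti|nti].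
    exists 1 => // u /andP[u0 _]; rewrite ptE (vP _ ti) mulr0 addr0 ti ltrDl.
    by rewrite mulr_gt0// exprn_gt0.
  have gap : 0 < sqdist x0 (c i) - r i ^+ 2 by rewrite subr_gt0 lt_def nti out.
  set D := v.1 * (x0.1 - (c i).1) + v.2 * (x0.2 - (c i).2).
  have D0 : 0 < 2 * `|D| + 1 by rewrite ltr_wpDl.
  exists ((sqdist x0 (c i) - r i ^+ 2) / (2 * `|D| + 1)); first exact: divr_gt0.
  move=> u /andP[u0]; rewrite ler_pdivlMr// ptE -/D => hu.
  have u2 : 0 < u ^+ 2 * V by rewrite mulr_gt0// exprn_gt0.
  have nD : - `|D| <= D by rewrite lerNnormlW.
  have : u * - `|D| <= u * D by rewrite ler_pM2l.
  by lra.
have V1 : 0 < 1 + V by rewrite addr_gt0.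
(* With u (1 + V) <= e both u and u V are at most e, so the squared displacement u^2 V is at most
   e^2. *)
pose u := Num.min e1 (e / (1 + V)).
have u0 : 0 < u by rewrite lt_min e10 divr_gt0.
have ue1 : u <= e1 by rewrite ge_min lexx.
have uV : u * (1 + V) <= e by rewrite -ler_pdivlMr// ge_min lexx orbT.
have /common_bound [e2 e20 He2] : forall i, i \in l ->
    exists2 f, 0 < f & forall w, 0 < w <= f -> (r i + w) ^+ 2 <= sqdist (c i) (pt u).
  move=> i il; have := He1 i il u; rewrite u0 ue1 => /(_ isT) far.
  have ri := r0 i; set g := sqdist (c i) (pt u) - r i ^+ 2.
  have g0 : 0 < g by rewrite subr_gt0.
  have ri1 : 0 < 2 * r i + 1 by lra.
  exists (Num.min 1 (g / (2 * r i + 1))); first by rewrite lt_min ltr01 divr_gt0.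
  move=> w /andP[w0]; rewrite le_min ler_pdivlMr// => /andP[w1 wg].
  have : w ^+ 2 <= w by rewrite expr2 ler_piMl// ltW.
  by move: wg; rewrite /g sqrrD; lra.
exists (pt u), (Num.min e2 e); split.
- have -> : sqdist x0 (pt u) = u * (u * V) by rewrite /sqdist /pt /V /=; ring.
  have uV0 : 0 < u * V by rewrite mulr_gt0.
  by rewrite expr2; apply: ler_pM; rewrite ?(ltW u0) ?(ltW uV0)//; lra.
- by rewrite lt_min e20 e0.
- by rewrite ge_min lexx orbT.
- by move=> i il; apply: He2 => //; rewrite lt_min e20 e0 ge_min lexx.
Qed.

Lemma supdist_le_sqdist p q (a : R) : 0 <= a -> sqdist p q <= a ^+ 2 -> supdist p q <= a.
Proof.
move=> a0; rewrite /sqdist => h; rewrite ge_max !ler_norml.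
by rewrite !ler_sqr_of//; have := sqr_ge0 (p.1 - q.1); have := sqr_ge0 (p.2 - q.2); lra.
Qed.

Lemma supdist_triangle p q z : supdist p z <= supdist p q + supdist q z.
Proof.
rewrite ge_max; apply/andP; split.
- apply: le_trans (ler_distD q.1 _ _) _.
  by apply: lerD; rewrite le_max lexx.
- apply: le_trans (ler_distD q.2 _ _) _.
  by apply: lerD; rewrite le_max lexx orbT.
Qed.

Lemma supdistC p q : supdist p q = supdist q p.
Proof. by rewrite /supdist distrC [X in Num.max _ X]distrC. Qed.

(* Either arbitrarily small disks accumulate at x0, and one of them is used;
   or only finitely many disks come close to x0. *)
Lemma exists_free_disk (c : nat -> R * R) (r : nat -> R) (x0 : R * R) (e : R) :
  (forall i, 0 < r i) ->
  (forall i j, i != j -> (r i + r j) ^+ 2 <= sqdist (c i) (c j)) ->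
  (forall i, r i ^+ 2 <= sqdist x0 (c i)) -> 0 < e ->
  exists z rho, [/\ 0 < rho, forall p, supdist p z <= 4 * rho -> supdist p x0 < e &
    forall i, rho < r i -> (r i + rho) ^+ 2 <= sqdist (c i) z].
Proof.
move=> r0 sep out e0.
have [[k small]|big] := pselect (exists k, supdist (c k) x0 + 4 * r k < e).
  exists (c k), (r k); split=> // [p pk|i ki].
    apply: le_lt_trans small; apply: le_trans (supdist_triangle p (c k) x0) _.
    by rewrite addrC lerD2l.
  by apply: sep; apply: contraTneq ki => ->; rewrite ltxx.
pose a := e / 10.
have a0 : 0 < a by rewrite divr_gt0.
(* The disks coming within a of x0 have radius at least a, since smaller ones fall under the first
   case; so [packing_bound] limits their number to 49. *)
pose A := [set i | sqdist (c i) x0 <= (r i + a) ^+ 2].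
have rA i : A i -> a <= r i.
  move=> Ai; rewrite leNgt; apply/negP => ri; apply: big; exists i.
  have ri0 := r0 i; have ra0 : 0 <= r i + a by lra.
  by have := supdist_le_sqdist ra0 Ai; rewrite /a in ri *; lra.
have finA : finite_set A.
  apply: contrapT => /(infinite_set_fset 50) [B BA szB].
  pose f (i : 'I_50) := nth 0%N (finmap.enum_fset B) i.
  have fB i : f i \in finmap.enum_fset B.
    by apply: mem_nth; apply: leq_trans szB; exact: ltn_ord.
  have fA i : A (f i) by apply: BA; exact: fB.
  suff : (50 <= 49)%N by [].
  apply: (@packing_bound R 50 (c \o f) (r \o f) x0 a a0) => [i|i|i j ij] /=.
  - exact: rA.
  - apply: le_trans (fA i) _; have := r0 (f i) => rf.
    by apply: lerXn2r; rewrite ?nnegrE; lra.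
  - apply: sep; rewrite nth_uniq ?finmap.fset_uniq//.
    + by apply: leq_trans szB; exact: ltn_ord.
    + by apply: leq_trans szB; exact: ltn_ord.
have [X AX] := finite_fsetP.1 finA.
have b0 : 0 < a / 2 by rewrite divr_gt0.
have [z [rho [zx rho0 rhob far]]] :=
  free_disk_finite (finmap.enum_fset X) r0 sep out b0.
exists z, rho; split=> // [p pz|i _].
  apply: le_lt_trans (supdist_triangle p z x0) _.
  have := supdist_le_sqdist (ltW b0) zx; rewrite supdistC /a in rhob *.
  by lra.
(* A disk outside [A] is more than a away from x0, while z is within a/2 of x0 and [rho] is at most
   a/2. *)
have [Ai|nA] := pselect (A i).
  by apply: far; rewrite AX in Ai; exact: Ai.
rewrite leNgt; apply/negP => close; apply: nA; rewrite /A /=.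
have ri0 := r0 i.
have rr0 : 0 <= r i + rho by lra.
rewrite sqdistC in zx.
apply: le_trans (sqdist_triangle rr0 (ltW b0) (ltW close) zx) _.
by apply: lerXn2r; rewrite ?nnegrE; lra.
Qed.

End FreeDisk.

(** * Hausdorff dimension *)

Section HausdorffBound.
Context {R : realType}.
Implicit Types (p z : R * R).

Lemma eucl_dist_lt p q (a : R) : 0 < a -> (eucl_dist p q < a) = (sqdist p q < a ^+ 2).
Proof.
move=> a0; rewrite -[a in LHS]gtr0_norm// -sqrtr_sqr /eucl_dist.
by rewrite ltr_sqrt// exprn_gt0.
Qed.

Lemma open_diskE c (r : R) : 0 < r -> open_disk c r = [set p | sqdist p c < r ^+ 2].
Proof.
by move=> r0; apply/seteqP; split=> p; rewrite /open_disk /= eucl_dist_lt// sqdistC.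
Qed.

Lemma eucl_dist_ge0 p q : 0 <= eucl_dist p q.
Proof. exact: sqrtr_ge0. Qed.

Lemma supdist_le_eucl p q : supdist p q <= eucl_dist p q.
Proof.
apply: supdist_le_sqdist; first exact: eucl_dist_ge0.
by rewrite /eucl_dist sqr_sqrtr// sqdist_ge0.
Qed.

Lemma ball_supdist z (e : R) : ball z e = [set p | supdist p z < e].
Proof.
apply/seteqP; split => p /=; rewrite supdistC /supdist gt_max.
- by move=> [h1 h2]; apply/andP.
- by move=> /andP[h1 h2].
Qed.

Lemma open_supdist z (e : R) : open [set p | supdist p z < e].
Proof.
rewrite openE => p pz; apply/nbhs_ballP; exists (e - supdist p z) => /=.
  by rewrite subr_gt0.
rewrite ball_supdist => q qp /=; apply: le_lt_trans (supdist_triangle q p z) _.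
by move: qp => /=; lra.
Qed.

Lemma open_open_disk c (r : R) : 0 < r -> open (open_disk c r).
Proof.
move=> r0; rewrite open_diskE// openE => p /= pc0.
have pc : eucl_dist p c < r by rewrite eucl_dist_lt.
set a := eucl_dist p c in pc.
have a0 : 0 <= a by exact: eucl_dist_ge0.
apply/nbhs_ballP; exists ((r - a) / 3) => /=; first by rewrite divr_gt0// subr_gt0.
rewrite ball_supdist => q /= qp.
have f0 : 0 <= 2 * ((r - a) / 3) by lra.
have h1 : sqdist q p <= (2 * ((r - a) / 3)) ^+ 2.
  move: qp f0; rewrite /supdist gt_max !ltr_norml /sqdist.
  move: (q.1 - p.1) (q.2 - p.2) ((r - a) / 3) => x y f.
  move=> /andP[/andP[? ?] /andP[? ?]] ?.
  have x2 : x ^+ 2 <= f ^+ 2 by nra.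
  have y2 : y ^+ 2 <= f ^+ 2 by nra.
  by rewrite exprMn; have := sqr_ge0 f; lra.
have h2 : sqdist p c <= a ^+ 2 by rewrite /a /eucl_dist sqr_sqrtr// sqdist_ge0.
apply: le_lt_trans (sqdist_triangle f0 a0 h1 h2) _.
by rewrite ltr_pXn2r// ?nnegrE; lra.
Qed.

Lemma compact_supdist z (a : R) : compact [set p | supdist p z <= a].
Proof.
have -> : [set p | supdist p z <= a] =
    `[z.1 - a, z.1 + a]%classic `*` `[z.2 - a, z.2 + a]%classic.
  apply/seteqP; split => p /=; rewrite /supdist ge_max !ler_norml !in_itv /=.
  - by move=> /andP[/andP[? ?] /andP[? ?]]; split; apply/andP; split; lra.
  - by move=> [/andP[? ?] /andP[? ?]]; apply/andP; split; apply/andP; split; lra.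
by apply: compact_setX; exact: segment_compact.
Qed.

Lemma finite_subcover z (a : R) (A : (set (R * R))^nat) :
  (forall i, open (A i)) -> [set p | supdist p z <= a] `<=` \bigcup_i A i ->
  exists n : nat, forall p, supdist p z <= a -> exists2 i, (i < n)%N & A i p.
Proof.
move=> oA cov; have /compact_near_coveringP near := @compact_supdist z a.
have [|n _ hn] := near nat \oo (fun n p => exists2 i, (i < n)%N & A i p) _; last first.
  by exists n => p; apply: (hn n) => /=.
move=> p pz; have [i _ Aip] := cov p pz.
exists (A i, [set n | (i < n)%N]) => /=.
  by split; [exact: open_nbhs_nbhs|exists i.+1].
by move=> [q n] /= [Aiq lin]; exists i.
Qed.

(** The last equation requires a nonempty set: for s = 0 the empty set would give 0^0 = 1 instead of
    0. *)
Lemma diamE_bounded (s : R) (U : set (R * R)) : (diam eucl_dist U <= 1%:E)%E ->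
  exists d : R, [/\ 0 <= d <= 1, forall p q, U p -> U q -> eucl_dist p q <= d,
    U = set0 -> d = 0 & U !=set0 -> diam_pow eucl_dist s U = (d `^ s)%:E].
Proof.
move=> U1; have ub := @ereal_sup_ubound R
  (0%E |` [set (eucl_dist p.1 p.2)%:E | p in U `*` U]).
have D0 : (0 <= diam eucl_dist U)%E by apply: ub; left.
have Dfin : diam eucl_dist U \is a fin_num.
  by rewrite ge0_fin_numE//; apply: le_lt_trans U1 _; rewrite ltry.
exists (fine (diam eucl_dist U)); split.
- by rewrite -!lee_fin fineK// D0 U1.
- move=> p q Up Uq; rewrite -lee_fin fineK//; apply: ub; right.
  by exists (p, q).
- move=> ->; rewrite /diam setX0 image_set0 setU0 ereal_sup1//.
- move=> /set0P /negbTE U0.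
  by rewrite /diam_pow U0 -[in LHS](fineK Dfin) poweR_EFin.
Qed.

Lemma sum_half_powers (n : nat) : \sum_(i < n) (2^-1 : R) ^+ i.+1 <= 1.
Proof.
suff -> : \sum_(i < n) (2^-1 : R) ^+ i.+1 = 1 - 2^-1 ^+ n.
  by rewrite lerBlDr lerDl exprn_ge0.
elim: n => [|n IH]; first by rewrite big_ord0 expr0 subrr.
by rewrite big_ord_recr /= IH exprS; field.
Qed.

(** Each covering set is enlarged to an open square around one of its points. By compactness
    finitely many disks and squares cover the closed square, and [finite_cover_bound] applies. *)
Lemma residual_covering_sum (t d b : R) : admissible t d b ->
  forall (c : nat -> R * R) (r : nat -> R) (z : R * R) (rho : R),
  (forall i, 0 < r i) ->
  (forall i j, i != j -> (r i + r j) ^+ 2 <= sqdist (c i) (c j)) ->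
  0 < rho -> (forall i, rho < r i -> (r i + rho) ^+ 2 <= sqdist (c i) z) ->
  exists2 eta, 0 < eta & forall (V : (set (R * R))^nat) (D : nat -> R),
  [set p | supdist p z <= 4 * rho] `\` \bigcup_i open_disk (c i) (r i)
     `<=` \bigcup_i V i ->
  (forall i, 0 <= D i) ->
  (forall i p q, V i p -> V i q -> eucl_dist p q <= D i) ->
  ~ forall n : nat, \sum_(i < n) D i * D i `^ t < eta.
Proof.
move=> adm c r z rho r0 sep rho0 far.
have [t01 _ _ _ _] := adm; case/andP: (t01) => t0 t1.
pose g (a : R) := a * a `^ t.
have g0 a : 0 <= a -> 0 <= g a by move=> a0; rewrite mulr_ge0 ?powR_ge0.
have gp a : 0 < a -> 0 < g a by move=> a0; rewrite mulr_gt0 ?powR_gt0.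
have gle a a' : 0 <= a -> a <= a' -> g a <= g a'.
  by move=> a0 aa'; apply: ler_pM; rewrite ?powR_ge0//; apply: ler_powRl; rewrite ?(ltW t0).
have K0 : 0 < @cover_const R.
  apply: mulr_gt0; first by rewrite ltr0n.
  apply: addr_gt0; apply: mulr_gt0; rewrite ?ltr0n//; exact: exprn_gt0.
have cover := finite_cover_bound adm.
move: (@cover_const R) K0 cover => K K0 cover.
have r8 : 0 < rho / 8 by rewrite divr_gt0.
(* The bound 1 gives f^(1+t) <= f for the enlargements f, rho/8 and g(rho/8) keep the enlargements
   and the diameters below rho/8, and the last bound makes the final sum too small. *)
pose eta := Num.min (Num.min 1 (rho / 8)) (Num.min (g (rho / 8)) (g rho / (16 * K))).
have eta0 : 0 < eta.
  by rewrite !lt_min ltr01 r8 gp//= divr_gt0 ?gp// mulr_gt0.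
exists eta => // V D cov D0 VD small.
have [eta1 eta8 etag etaK] :
    [/\ eta <= 1, eta <= rho / 8, eta <= g (rho / 8) & eta <= g rho / (16 * K)].
  by split; rewrite /eta !ge_min lexx ?orbT.
(* A geometric sequence of enlargements, of sum at most [eta]. *)
pose f (i : nat) := eta * 2^-1 ^+ i.+1.
have half0 (i : nat) : 0 < (2^-1 : R) ^+ i by exact: exprn_gt0.
have f0 i : 0 < f i by rewrite mulr_gt0.
have fle i : f i <= eta.
  by rewrite ler_piMr ?(ltW eta0)// exprn_ile1//; lra.
pose e i := D i + f i.
have e0 i : 0 < e i by rewrite ltr_wpDl.
have Dsmall i : D i <= rho / 8.
  rewrite leNgt; apply/negP => big; have := small i.+1; apply/negP; rewrite -leNgt.
  rewrite big_ord_recr /= -[leLHS]add0r; apply: lerD.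
    by apply: sumr_ge0 => j _; exact: g0.
  by apply: le_trans etag _; apply: gle (ltW big); exact: ltW.
have esmall i : 2 * e i <= rho by have := Dsmall i; have := fle i; rewrite /e; lra.
(* For an empty [V i] this is a default point, whose square is harmless. *)
pose x i := get (V i).
have Vx i p : V i p -> supdist p (x i) < e i.
  move=> Vp; apply: le_lt_trans (supdist_le_eucl p (x i)) _.
  have Vx : V i (x i) by exact: getI Vp.
  by apply: le_lt_trans (VD i p (x i) Vp Vx) _; rewrite ltrDl.
(* Disk i and square i are merged, so that one finite index bounds both families. *)
pose A i := open_disk (c i) (r i) `|` [set p | supdist p (x i) < e i].
have oA i : open (A i).
  by apply: openU; [exact: open_open_disk|exact: open_supdist].
have covA : [set p | supdist p z <= 4 * rho] `<=` \bigcup_i A i.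
  move=> p pz; have [[i _ pi]|np] := pselect ((\bigcup_i open_disk (c i) (r i)) p).
    by exists i => //; left.
  have [i _ Vp] : (\bigcup_i V i) p by apply: cov; split.
  by exists i => //; right; exact: Vx.
have [n hn] := finite_subcover oA covA.
have : g rho <= K * \sum_(j < n) g (e j).
  apply: (cover n n (fun i => c i) (fun i => r i) (fun j => x j) (fun j => e j) z rho
    (fun i => r0 i) (fun j => e0 j) (fun i j ij => sep i j ij) rho0
    (fun j => esmall j) (fun i => far i)) => p pz.
  have [i lin [pi|pi]] := hn p pz.
  - left; exists (Ordinal lin); by move: pi; rewrite open_diskE.
  - by right; exists (Ordinal lin).
have ge i : g (e i) <= 4 * (g (D i) + f i).
  have m0 : 0 <= Num.max (D i) (f i) by rewrite le_max D0.
  have le2 : e i <= 2 * Num.max (D i) (f i).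
    have : D i <= Num.max (D i) (f i) by rewrite le_max lexx.
    have : f i <= Num.max (D i) (f i) by rewrite le_max lexx orbT.
    by rewrite /e; lra.
  apply: le_trans (gle _ _ (ltW (e0 i)) le2) _.
  have h1 : g (2 * Num.max (D i) (f i)) <= 4 * g (Num.max (D i) (f i)).
    rewrite /g; have h := powR_double t01 m0.
    have m20 : 0 <= 2 * Num.max (D i) (f i) by rewrite mulr_ge0.
    by have := ler_wpM2l m20 h; lra.
  apply: le_trans h1 _; rewrite ler_pM2l//.
  have gf : g (f i) <= f i.
    rewrite /g ler_piMr ?(ltW (f0 i))//.
    have := ler_powRl (ltW t0) (ltW (f0 i)) (le_trans (fle i) eta1).
    by rewrite powR1.
  have [_|_] := leP (D i) (f i).
    by have := g0 _ (D0 i); lra.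
  by have := f0 i; lra.
have sume : \sum_(j < n) g (e j) < 8 * eta.
  apply: (@le_lt_trans _ _ (4 * (\sum_(j < n) g (D j) + \sum_(j < n) f j))).
    by rewrite -big_split mulr_sumr; apply: ler_sum => j _; exact: ge.
  have hf : \sum_(j < n) f j <= eta.
    by rewrite -mulr_sumr ler_piMr ?(ltW eta0)//; exact: sum_half_powers.
  by have := small n; rewrite -/g; lra.
apply/negP; rewrite -ltNge.
have : K * \sum_(j < n) g (e j) < K * (8 * eta) by rewrite ltr_pM2l.
have : K * (8 * eta) <= g rho / 2.
  move: etaK; rewrite ler_pdivlMr ?mulr_gt0//; lra.
have := gp _ rho0; lra.
Qed.

End HausdorffBound.

(** If the measure of dimension s vanished for some s < 1 + t, covers by sets of diameter at most 1
    would have arbitrarily small sums of s-th powers, hence of (1 + t)-th powers, against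
    [residual_covering_sum]. *)
Theorem corollary1p2 (R : realType) :
  exists K : R, 1 < K /\
    forall Omega : set (R * R), open Omega ->
    forall D : (set (R * R))^nat, circle_packing Omega D ->
    residual_set Omega D !=set0 ->
    (K%:E < hausdorff_dim eucl_dist (residual_set Omega D))%E.
Proof.
have [t [d [b adm]]] := @exists_admissible R.
have [t01 _ _ _ _] := adm; case/andP: (t01) => t0 t1.
(* The dimension is shown to be at least 1 + t; halving t makes the inequality strict. *)
exists (1 + t / 2); split=> [|Omega oO D [isD DO tD] [x0 [Ox0 nDx0]]].
  by rewrite ltrDl divr_gt0.
apply: (@lt_le_trans _ _ (1 + t)%:E); first by rewrite lte_fin; lra.
apply/ereal_infP => _ [s [s0 Hs] <-]; rewrite lee_fin leNgt; apply/negP => st.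
have /choice [cr Hcr] : forall i, exists cr : (R * R) * R,
    0 < cr.2 /\ D i = open_disk cr.1 cr.2.
  by move=> i; have [c [r r0 ->]] := isD i; exists (c, r).
pose c i := (cr i).1; pose r i := (cr i).2.
have r0 i : 0 < r i by have [] := Hcr i.
have DE i : D i = open_disk (c i) (r i) by have [] := Hcr i.
have sep i j : i != j -> (r i + r j) ^+ 2 <= sqdist (c i) (c j).
  move=> ij; apply: disjoint_disks_separated => // u ui uj.
  move/negP: ij; apply; apply/eqP; apply: (tD i j I I); exists u; rewrite !DE.
  by rewrite !open_diskE.
have out i : r i ^+ 2 <= sqdist x0 (c i).
  rewrite leNgt; apply/negP => x0i; apply: nDx0.
  by exists i => //; rewrite DE open_diskE.
have [e0 /= e00 eO] : exists2 e : R, 0 < e & forall p, supdist p x0 < e -> Omega p.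
  have /nbhs_ballP [e e0 He] := open_nbhs_nbhs (conj oO Ox0).
  by exists e => // p px; apply: He; rewrite ball_supdist.
have [z [rho [rho0 zO far]]] := exists_free_disk r0 sep out e00.
have [eta eta0 bound] := residual_covering_sum adm r0 sep rho0 far.
(* The scale 1 suffices: powers of diameters at most 1 decrease with the exponent. *)
have pre0 : (hausdorff_premeasure eucl_dist s 1 (residual_set Omega D) < eta%:E)%E.
  apply: (@le_lt_trans _ _ 0%E); last by rewrite lte_fin.
  by rewrite -Hs; apply: ereal_sup_ubound; exists 1 => //=.
have [_ [V [Vcov Vdiam] <-] Vsum] := ereal_inf_lt pre0.
have /choice [dd Hdd] := fun i => diamE_bounded s (Vdiam i).
apply: (bound V dd).
- move=> p [pz np]; apply: Vcov; split; first exact/eO/zO.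
  by move=> [i _ pi]; apply: np; exists i => //; rewrite -DE.
- by move=> i; have [/andP[]] := Hdd i.
- by move=> i; have [] := Hdd i.
move=> n; rewrite -lte_fin; apply: le_lt_trans Vsum.
have pow_ge0 i : (0 <= diam_pow eucl_dist s (V i))%E.
  by rewrite /diam_pow; case: ifP => // _; exact: poweR_ge0.
apply: (@le_trans _ _ (\sum_(0 <= i < n) diam_pow eucl_dist s (V i))%E); last first.
  exact: nneseries_lim_ge.
rewrite big_mkord -sumEFin; apply: lee_sum => i _.
have [/andP[d0 d1] _ Vempty Vne] := Hdd i.
(* An empty set has [dd i = 0] and adds nothing to the real sum, whatever s is. *)
have [V0|/set0P V0] := eqVneq (V i) set0.
  by rewrite Vempty// mul0r; exact: pow_ge0.
rewrite Vne// lee_fin.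
have [->|dn] := eqVneq (dd i) 0; first by rewrite mul0r powR_ge0.
have dp : 0 < dd i by rewrite lt_def dn.
rewrite -[X in X * _](powRr1 d0) -powRD ?dn ?implybT//.
by apply: ger_powR; rewrite ?dp ?d1// ltW.
Qed.
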